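(* Let $\phi:\mathcal{R}\times P_{\mathbb{Q}}|_{\hat{\mathbb{Z}}}\to\mathcal{G}_{tight}$ be the map defined by $$\phi\Big(\Big(r,\begin{bmatrix}1&0\\ \frac{k}{m}&\frac{n}{m}\end{bmatrix}\Big)\Big)=[(r,s_{m}^{*}u^{k}s_{n})]\qquad (m,n\in\mathbb{Z}\setminus\{0\},\ k\in\mathbb{Z}).$$ Then $\phi$ is a topological groupoid isomorphism.
   Context: **The algebra and the inverse semigroup.** $U[\mathbb{Z}]$ is the universal $C^*$-algebra generated by a set of unitaries $\{u^{n}:n\in\mathbb{Z}\}$ and a set of isometries $\{s_{m}:m\in\mathbb{Z}^{\times}\}$ ($\mathbb{Z}^{\times}$ = non-zero integers) satisfying $s_{m}s_{n}=s_{mn}$, $u^{n}u^{m}=u^{n+m}$, $s_{m}u^{n}=u^{mn}s_{m}$, and $\sum_{n\in\mathbb{Z}/(m)}u^{n}e_{m}u^{-n}=1$, where $e_{m}:=s_{m}s_{m}^{*}$. Let $T:=\{s_{m}^{*}u^{n}e_{k}u^{n'}s_{m'} : m,m',k \in \mathbb{Z}^{\times},\ n,n' \in \mathbb{Z}\}\cup\{0\}$; it is an inverse semigroup of partial isometries with set of projections $P:=\{u^{n}e_{m}u^{-n}:m\in\mathbb{Z}^{\times},n\in\mathbb{Z}\}\cup\{0\}$. **The tight groupoid.** A character of $P$ is a map $x:P\to\{0,1\}$, not identically zero, that is a semigroup homomorphism with $x(0)=0$. The set $\hat{P}_{0}$ of characters carries the topology induced from the product topology on $\{0,1\}^{P}$.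 A character is maximal if its support $\{e\in P:x(e)=1\}$ is maximal under inclusion among supports of characters; $\hat{P}_{tight}$ is the closure in $\hat{P}_{0}$ of the set of maximal characters. For $s\in T$ let $D_{s}:=\{x\in\hat{P}_{0}:x(ss^{*})=1\}$, and for $x\in D_{s}$ let $(x.s)(e):=x(ses^{*})$. On $\Sigma:=\{(x,s):s\in T,\ x\in D_{s}\}$ put $(x,s)(y,t):=(x,st)$ if $y=x.s$, $(x,s)^{-1}:=(x.s,s^{*})$, and $(x,s)\sim(y,t)$ if $x=y$ and there is $e\in P$ with $x(e)=1$ and $es=et$. Let $\mathcal{G}:=\Sigma/\sim$ with classes $[(x,s)]$ and induced groupoid operations, with the topology having basis $\theta(s,U):=\{[(x,s)]:x\in U\}$, $s\in T$, $U\subset D_{s}$ open. $\mathcal{G}_{tight}$ is the reduction of $\mathcal{G}$ to the invariant subset $\hat{P}_{tight}$ of its unit space $\hat{P}_{0}$. **Identification of the unit space.** $\hat{\mathbb{Z}}=\{(r_{m})\in\prod_{m\in\mathbb{N}^{+}}\mathbb{Z}/(m):r_{mk}\equiv r_{m}\bmod m\}$ is the profinite completion of $\mathbb{Z}$ ($\mathbb{N}^{+}$ = strictly positive integers). The space $\hat{P}_{tight}$ is identified with $\hat{\mathbb{Z}}$ via the homeomorphism $r\mapsto\xi_{r}$, where $\xi_{r}(u^{n}e_{m}u^{-n})=1$ if $r_{m}\equiv n\bmod m$ and $0$ otherwise (with $r_{m}:=r_{|m|}$ for negative $m$), and $\xi_{r}(0)=0$. Thus $[(r,s)]$ means $[(\xi_{r},s)]$.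 **The transformation groupoid.** Order $\mathbb{N}^{+}$ by divisibility; for $m\in\mathbb{N}^{+}$ let $\mathcal{R}_{m}:=\hat{\mathbb{Z}}$, and let $\mathcal{R}_{m}\to\mathcal{R}_{\ell m}$ be multiplication by $\ell$. $\mathcal{R}$ is the inductive limit of this system, a locally compact Hausdorff abelian group containing $\hat{\mathbb{Z}}=\mathcal{R}_{1}$. The group $P_{\mathbb{Q}}:=\Big\{\begin{bmatrix}1&0\\ b&a\end{bmatrix}:a\in\mathbb{Q}^{\times},b\in\mathbb{Q}\Big\}$, considered as a discrete group, acts on the left of $\mathcal{R}$ by: for $x\in\mathcal{R}_{p}$ and $m'\in\mathbb{N}^{+}$, $\begin{bmatrix}1&0\\ \frac{n}{m'}&\frac{m}{m'}\end{bmatrix}x=mx+np\in\mathcal{R}_{m'p}$. It acts on the right by $x.g:=g^{-1}x$. The transformation groupoid $\mathcal{R}\times P_{\mathbb{Q}}$ has product $(x,g)(y,h)=(x,gh)$ if $y=x.g$, inverse $(x,g)^{-1}=(x.g,g^{-1})$, and the product topology. $\mathcal{R}\times P_{\mathbb{Q}}|_{\hat{\mathbb{Z}}}$ denotes its restriction to $\hat{\mathbb{Z}}$, i.e. $\{(r,g):r\in\hat{\mathbb{Z}},\ r.g\in\hat{\mathbb{Z}}\}$. The element $s_{m}^{*}u^{k}s_{n}$ depends only on the rationals $\frac{k}{m}$ and $\frac{n}{m}$. *)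

(* Defs.v *)
From HB Require Import structures.
From mathcomp Require Import all_boot all_order all_algebra.
From mathcomp Require Import generic_quotient complex.
From mathcomp Require Import all_classical all_reals topology.
From mathcomp Require Import zify ring lra.
Import Order.TTheory GRing.Theory Num.Theory.

Set Implicit Arguments.
Unset Strict Implicit.
Unset Printing Implicit Defensive.

Local Open Scope classical_set_scope.
Local Open Scope ring_scope.
Local Open Scope complex_scope.

(* Unital C*-algebras with 1 != 0. The norm is a field of the mixin because
   Hierarchy-Builder has no join of the normed modules with the algebras. *)
HB.mixin Record isCStarAlgebra (R : realType) A of GRing.Algebra R[i] A := {
  star : A -> A;
  cnorm : A -> R;
  cnorm0_eq0 : forall x : A, cnorm x = 0 -> x = 0;
  cnormD_le : forall x y : A, cnorm (x + y) <= cnorm x + cnorm y;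
  cnormZ : forall (a : R[i]) (x : A),
    (cnorm (a *: x))%:C = `|a| * (cnorm x)%:C;
  cnormM_le : forall x y : A, cnorm (x * y) <= cnorm x * cnorm y;
  cnorm_complete : forall x : nat -> A,
    (forall e : R, 0 < e -> exists N, forall m n,
       (N <= m)%N -> (N <= n)%N -> cnorm (x m - x n) < e) ->
    exists l : A, forall e : R, 0 < e -> exists N, forall n,
       (N <= n)%N -> cnorm (x n - l) < e;
  starK : involutive star;
  starD : {morph star : x y / x + y};
  starZ : forall (a : R[i]) (x : A), star (a *: x) = a^* *: star x;
  starM : forall x y : A, star (x * y) = star y * star x;
  cstar_identity : forall x : A, cnorm (star x * x) = cnorm x ^+ 2
}.

#[short(type="cstarAlgType")]
HB.structure Definition CStarAlgebra (R : realType) :=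
  {A of GRing.Algebra R[i] A & isCStarAlgebra R A}.

(* The value of s at 0 is junk: the isometries are indexed by nonzero m. *)
Record UZ_relations (R : realType) (A : cstarAlgType R) (u s : int -> A)
    : Prop := {
  uz_unitary : forall n, star (u n) * u n = 1 /\ u n * star (u n) = 1;
  uz_isometry : forall m, m != 0 -> star (s m) * s m = 1;
  uz_sM : forall m n, m != 0 -> n != 0 -> s m * s n = s (m * n);
  uz_uD : forall n m, u n * u m = u (n + m);
  uz_su : forall m n, m != 0 -> s m * u n = u (m * n) * s m;
  uz_sum : forall m, m != 0 ->
    \sum_(n < `|m|%N) u n%:Z * (s m * star (s m)) * u (- n%:Z) = 1
}.

Definition UZ_hom (R : realType) (A B : cstarAlgType R)
    (u s : int -> A) (u' s' : int -> B) (f : {lrmorphism A -> B}) : Prop :=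
  [/\ forall a, f (star a) = star (f a),
      forall n, f (u n) = u' n
    & forall m, m != 0 -> f (s m) = s' m].

(* U[Z], determined up to isomorphism by its universal property; uniqueness of
   the *-homomorphism also says that the u n and the s m generate. *)
Record UZ (R : realType) := {
  uz_alg :> cstarAlgType R;
  uz_u : int -> uz_alg;
  uz_s : int -> uz_alg;
  uz_rel : UZ_relations uz_u uz_s;
  uz_universal : forall (B : cstarAlgType R) (u' s' : int -> B),
    UZ_relations u' s' ->
    exists f : {lrmorphism uz_alg -> B},
      UZ_hom uz_u uz_s u' s' f /\
      forall g : {lrmorphism uz_alg -> B}, UZ_hom uz_u uz_s u' s' g -> g =1 f
}.

Definition uz_e (R : realType) (U : UZ R) (m : int) : U :=
  uz_s U m * star (uz_s U m).

Definition uz_T (R : realType) (U : UZ R) : set U :=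
  [set a | a = 0 \/ exists m m' k n n' : int,
     [/\ m != 0, m' != 0, k != 0
       & a = star (uz_s U m) * uz_u U n * uz_e U k * uz_u U n' * uz_s U m']].

Definition uz_P (R : realType) (U : UZ R) : set U :=
  [set a | a = 0 \/ exists m n : int,
     m != 0 /\ a = uz_u U n * uz_e U m * uz_u U (- n)].

Arguments uz_T {R} U _.
Arguments uz_P {R} U _.

(* {0,1}^P, with bool for {0,1} *)
Definition Pfun (R : realType) (U : UZ R) : topologicalType :=
  prod_topology (fun _ : set_type (uz_P U) => bool).

(* [ev x a] is x(a) when a is in P, and false otherwise; below it is only
   applied to elements e * f, s * e * s^* and s * s^* (e, f in P, s in T),
   which are in P. *)
Definition ev (R : realType) (U : UZ R) (x : Pfun U) (a : U) : bool :=
  `[< exists2 e : set_type (uz_P U), val e = a & x e >].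

Definition is_char (R : realType) (U : UZ R) : set (Pfun U) :=
  [set x : Pfun U | [/\ exists e, x e,
               forall e f : set_type (uz_P U),
                 ev x (val e * val f) = x e && x f
             & ev x 0 = false]].

Arguments is_char {R} U _.

Definition hatP0 (R : realType) (U : UZ R) : topologicalType :=
  set_type (is_char U).

Definition supp (R : realType) (U : UZ R) (x : hatP0 U)
  : set (set_type (uz_P U)) := [set e | val x e].

Definition maximal_char (R : realType) (U : UZ R) : set (hatP0 U) :=
  [set x | forall y : hatP0 U, supp x `<=` supp y -> supp y = supp x].

Arguments maximal_char {R} U _.

Definition hatPtight (R : realType) (U : UZ R) : set (hatP0 U) :=
  closure (maximal_char U).

Arguments hatPtight {R} U _.

Definition dom (R : realType) (U : UZ R) (s : U) : set (hatP0 U) :=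
  [set x | ev (val x) (s * star s)].

(* x.s as a plain function P -> {0,1}; it is a character when x is in D_s. *)
Definition ract (R : realType) (U : UZ R) (x : Pfun U) (s : U) : Pfun U :=
  fun e => ev x (s * val e * star s).

Definition Sigma (R : realType) (U : UZ R) : set (Pfun U * U) :=
  [set p | uz_T U p.2 /\ exists2 x : hatP0 U, dom p.2 x & val x = p.1].

Arguments Sigma {R} U _.

Definition germ_rel (R : realType) (U : UZ R) (p q : Pfun U * U) : Prop :=
  p.1 = q.1 /\
  exists2 e : set_type (uz_P U), p.1 e & val e * p.2 = val e * q.2.

(* Sigma/~ is the set of classes, as subsets of Sigma. [germ (x, s)] needs no
   proof that (x, s) is in Sigma; it is a class only when this is the case. *)
Definition germ (R : realType) (U : UZ R) (p : Pfun U * U)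
  : set (Pfun U * U) := [set q | Sigma U q /\ germ_rel p q].

Definition germs (R : realType) (U : UZ R) : Type :=
  set_type [set c | exists2 p, Sigma U p & c = germ p].

HB.instance Definition _ (R : realType) (U : UZ R) :=
  Choice.copy (germs U)
    (set_type [set c | exists2 p, Sigma U p & c = germ p]).

Definition germ_set (R : realType) (U : UZ R) (c : germs U)
  : set (Pfun U * U) := val c.

Definition theta (R : realType) (U : UZ R) (i : U * set (hatP0 U))
  : set (germs U) :=
  [set c | exists2 x : hatP0 U, i.2 x & germ_set c = germ (val x, i.1)].

HB.instance Definition _ (R : realType) (U : UZ R) :=
  isPointed.Build (uz_alg U) 0.

(* The theta(s,W) are closed under finite intersections up to unions, so the
   topology they generate is the one of which they are a basis. *)
HB.instance Definition _ (R : realType) (U : UZ R) :=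
  @isSubBaseTopological.Build (germs U) (uz_alg U * set (hatP0 U))%type
    [set i | [/\ uz_T U i.1, open i.2 & i.2 `<=` dom i.1]] (@theta R U).

Definition Npos : Type := {n : nat | (0 < n)%N}.

HB.instance Definition _ := Choice.copy Npos {n : nat | (0 < n)%N}.

Definition mulNpos (l m : Npos) : Npos :=
  exist (fun n => (0 < n)%N) (val l * val m)%N
    (etrans (muln_gt0 (val l) (val m)) (introT andP (conj (valP l) (valP m)))).

(* Z/(m) is represented by the residues 'I_m *)
Definition Zhat_set
  : set (prod_topology (fun m : Npos => discrete_topology 'I_(val m))) :=
  [set r | forall m k : Npos, r (mulNpos m k) = r m %[mod val m]].

Definition Zhat : Type := set_type Zhat_set.

HB.instance Definition _ := Topological.copy Zhat (set_type Zhat_set).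

Definition zcomp (r : Zhat) (m : Npos) : 'I_(val m) := val r m.

Lemma Zhat_eq (r t : Zhat) : (forall m, zcomp r m = zcomp t m :> nat) -> r = t.
Proof.
move=> h; apply: val_inj; apply: functional_extensionality_dep => m.
exact/val_inj/h.
Qed.

Lemma Zhat_mk_subproof (f : Npos -> nat)
    (fP : forall m k, f (mulNpos m k) = f m %[mod val m]) :
  (fun m => Ordinal (ltn_pmod (f m) (valP m))) \in Zhat_set.
Proof.
apply/mem_set => m k /=.
by rewrite modn_mod modn_dvdm ?dvdn_mulr // fP.
Qed.

Definition Zhat_mk (f : Npos -> nat)
    (fP : forall m k, f (mulNpos m k) = f m %[mod val m]) : Zhat :=
  SigSub (Zhat_mk_subproof fP).

Lemma zcomp_mk f fP m : zcomp (@Zhat_mk f fP) m = (f m %% val m)%N :> nat.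
Proof. by []. Qed.

Lemma zcompP (r : Zhat) m k :
  zcomp r (mulNpos m k) = zcomp r m %[mod val m].
Proof. exact: (set_mem (valP r)). Qed.

Fact Zhat_addP (r t : Zhat) m k :
  (zcomp r (mulNpos m k) + zcomp t (mulNpos m k) =
   zcomp r m + zcomp t m %[mod val m])%N.
Proof. by rewrite -modnDm !zcompP modnDm. Qed.

Fact Zhat_oppP (r : Zhat) m k :
  (val (mulNpos m k) - zcomp r (mulNpos m k) =
   val m - zcomp r m %[mod val m])%N.
Proof.
set a := zcomp r _; set b := zcomp r m.
have ab : (a = b %[mod val m])%N by exact: zcompP.
have ha : (a <= val (mulNpos m k))%N by exact/ltnW/ltn_ord.
have hb : (b <= val m)%N by exact/ltnW/ltn_ord.
apply/eqP; rewrite -(eqn_modDr a) subnK //.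
by rewrite -modnDmr ab modnDmr subnK // modnn modnMr.
Qed.

Definition Zhat_add (r t : Zhat) : Zhat := Zhat_mk (Zhat_addP r t).
Definition Zhat_opp (r : Zhat) : Zhat := Zhat_mk (Zhat_oppP r).
Definition Zhat_zero : Zhat := @Zhat_mk (fun=> 0%N) (fun _ _ => erefl).
Definition Zhat_one : Zhat := @Zhat_mk (fun=> 1%N) (fun _ _ => erefl).

Fact Zhat_addA : associative Zhat_add.
Proof.
by move=> x y z; apply: Zhat_eq => m; rewrite !zcomp_mk modnDml modnDmr addnA.
Qed.
Fact Zhat_addC : commutative Zhat_add.
Proof. by move=> x y; apply: Zhat_eq => m; rewrite !zcomp_mk addnC. Qed.
Fact Zhat_add0 : left_id Zhat_zero Zhat_add.
Proof.
by move=> x; apply: Zhat_eq => m; rewrite !zcomp_mk mod0n add0n modn_small.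
Qed.
Fact Zhat_addN : left_inverse Zhat_zero Zhat_opp Zhat_add.
Proof.
move=> x; apply: Zhat_eq => m; rewrite !zcomp_mk modnDml subnK ?modnn ?mod0n //.
exact/ltnW/ltn_ord.
Qed.

HB.instance Definition _ :=
  GRing.isZmodule.Build Zhat Zhat_addA Zhat_addC Zhat_add0 Zhat_addN.

(* The inductive limit of R_m = Zhat, m in N+: the quotient of the disjoint
   union, whose elements are pairs [existT _ m x] with x in R_m. *)
Definition Rpre : topologicalType := {m : Npos & Zhat}.

Definition Rrel (x y : Rpre) : bool :=
  `[< exists l l' : Npos, mulNpos l (projT1 x) = mulNpos l' (projT1 y) /\
        projT2 x *+ val l = projT2 y *+ val l' >].

Lemma mulNposA : associative mulNpos.
Proof. by move=> a b c; apply: val_inj; rewrite /= mulnA. Qed.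
Lemma mulNposC : commutative mulNpos.
Proof. by move=> a b; apply: val_inj; rewrite /= mulnC. Qed.
Lemma mulNposI l : injective (mulNpos l).
Proof.
move=> a b /(congr1 val) /= /eqP; rewrite eqn_pmul2l ?(valP l) // => /eqP.
exact: val_inj.
Qed.

Lemma Rrel_refl : reflexive Rrel.
Proof. by move=> x; apply/asboolP; exists (projT1 x), (projT1 x). Qed.

Lemma Rrel_sym : symmetric Rrel.
Proof.
by move=> x y; apply/asboolP/asboolP => -[l [l' [h1 h2]]]; exists l', l.
Qed.

Lemma Rrel_trans : transitive Rrel.
Proof.
move=> y x z /asboolP[l [l' [h1 h2]]] /asboolP[k [k' [h3 h4]]].
apply/asboolP; exists (mulNpos k l), (mulNpos l' k'); split.
  by rewrite -mulNposA h1 mulNposA (mulNposC k) -!mulNposA h3.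
by rewrite /= mulnC mulrnA h2 -mulrnA mulnC mulrnA h4 -mulrnA mulnC.
Qed.

Canonical Rrel_equiv := EquivRel Rrel Rrel_refl Rrel_sym Rrel_trans.

Local Open Scope quotient_scope.

Definition Rlim : topologicalType := quotient_topology {eq_quot Rrel}.

Definition Rin (p : Npos) (x : Zhat) : Rlim :=
  \pi_({eq_quot Rrel}) (existT _ p x : Rpre).

Definition Npos1 : Npos := exist (fun n => (0 < n)%N) 1%N isT.

Definition embR (r : Zhat) : Rlim := Rin Npos1 r.

Lemma Rin_eq p q x y :
  Rin p x = Rin q y <-> exists l l' : Npos,
    mulNpos l p = mulNpos l' q /\ x *+ val l = y *+ val l'.
Proof.
split=> [h|h].
  have /eqmodP /asboolP // : existT _ p x = existT _ q y %[mod {eq_quot Rrel}].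
  exact: h.
suff : existT _ p x = existT _ q y %[mod {eq_quot Rrel}] by [].
by apply/eqmodP/asboolP.
Qed.

(* [[1, 0], [b, a]] *)
Definition aff (b a : rat) : 'M[rat]_2 :=
  \matrix_(i, j) (if i == 0 then (j == 0)%:R else if j == 0 then b else a).

Definition inPQ (g : 'M[rat]_2) : bool :=
  [&& g 0 0 == 1, g 0 1 == 0 & g 1 1 != 0].

Record PQ : Type := MkPQ { PQmx :> 'M[rat]_2 ; _ : inPQ PQmx }.

HB.instance Definition _ := [isSub for PQmx].
HB.instance Definition _ := [Choice of PQ by <:].
HB.instance Definition _ := Topological.copy PQ (discrete_topology PQ).

Lemma ord2P (P : 'I_2 -> Prop) : P 0 -> P 1 -> forall i, P i.
Proof.
move=> h0 h1 [[|[|//]] hi].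
  by rewrite (_ : Ordinal hi = 0) //; exact: val_inj.
by rewrite (_ : Ordinal hi = 1) //; exact: val_inj.
Qed.

Lemma inPQ_aff b a : a != 0 -> inPQ (aff b a).
Proof. by move=> a0; rewrite /inPQ !mxE /= ?eqxx a0. Qed.

Lemma PQ_aff (g : PQ) : PQmx g = aff (g 1 0) (g 1 1).
Proof.
case: g => g /= /and3P[/eqP h1 /eqP h2 _].
by apply/matrixP; apply: ord2P; apply: ord2P; rewrite !mxE.
Qed.

Lemma PQ11 (g : PQ) : g 1 1 != 0.
Proof. by case: g => g /= /and3P[]. Qed.

Lemma aff_mul b a b' a' : aff b a *m aff b' a' = aff (b + a * b') (a * a').
Proof.
apply/matrixP; apply: ord2P; apply: ord2P;
  rewrite !mxE !big_ord_recl big_ord0 !mxE /=; ring.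
Qed.

Lemma aff1 : aff 0 1 = 1%:M.
Proof. by apply/matrixP; apply: ord2P; apply: ord2P; rewrite !mxE. Qed.

Fact PQ_mul_subproof (g h : PQ) : inPQ (PQmx g *m PQmx h).
Proof. by rewrite (PQ_aff g) (PQ_aff h) aff_mul inPQ_aff // mulf_neq0 ?PQ11. Qed.

Definition PQ_mul (g h : PQ) : PQ := MkPQ (PQ_mul_subproof g h).
Definition PQ_one : PQ := MkPQ (inPQ_aff 0 (oner_neq0 rat)).
Fact PQ_inv_subproof (g : PQ) : inPQ (aff (- (g 1 0 / g 1 1)) (g 1 1)^-1).
Proof. by rewrite inPQ_aff // invr_eq0 PQ11. Qed.
Definition PQ_inv (g : PQ) : PQ := MkPQ (PQ_inv_subproof g).

Fact PQ_mulA : associative PQ_mul.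
Proof. by move=> x y z; apply: val_inj; rewrite /= mulmxA. Qed.
Fact PQ_mul1 : left_id PQ_one PQ_mul.
Proof. by move=> x; apply: val_inj; rewrite /= aff1 mul1mx. Qed.
Fact PQ_mulr1 : right_id PQ_one PQ_mul.
Proof. by move=> x; apply: val_inj; rewrite /= aff1 mulmx1. Qed.
Fact PQ_mulV : left_inverse PQ_one PQ_inv PQ_mul.
Proof.
move=> x; apply: val_inj; rewrite /= [in X in _ *m X]PQ_aff aff_mul.
by congr aff; field; exact: PQ11.
Qed.
Fact PQ_mulrV : right_inverse PQ_one PQ_inv PQ_mul.
Proof.
move=> x; apply: val_inj; rewrite /= [in X in X *m _]PQ_aff aff_mul.
by congr aff; field; exact: PQ11.
Qed.

HB.instance Definition _ :=
  isGroup.Build PQ PQ_mulA PQ_mul1 PQ_mulr1 PQ_mulV PQ_mulrV.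

Fact absdenq_gt0 (q : rat) : (0 < `|denq q|)%N.
Proof. by rewrite absz_gt0 denq_neq0. Qed.

Definition absdenq (q : rat) : Npos := exist (fun n => (0 < n)%N) _ (absdenq_gt0 q).

(* The formula for g x, read off the fraction with the common denominator
   m' = denq (g 1 0) * denq (g 1 1); [lactE] gives it for all fractions. *)
Definition lact (g : PQ) (X : Rlim) : Rlim :=
  let: existT p x := repr X in
  let n := numq (g 1 0) * denq (g 1 1) in
  let m := numq (g 1 1) * denq (g 1 0) in
  Rin (mulNpos (mulNpos (absdenq (g 1 0)) (absdenq (g 1 1))) p)
    (x *~ m + Zhat_one *~ (n * (val p)%:Z)).

Lemma lactE (g : PQ) (p m' : Npos) (m n : int) (x : Zhat) :
  PQmx g = aff (n%:Q / (val m')%:Q) (m%:Q / (val m')%:Q) ->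
  lact g (Rin p x) = Rin (mulNpos m' p) (x *~ m + Zhat_one *~ (n * (val p)%:Z)).
Proof.
move=> gE.
have gb : g 1 0 = n%:Q / (val m')%:Q by rewrite gE !mxE.
have ga : g 1 1 = m%:Q / (val m')%:Q by rewrite gE !mxE.
rewrite /lact; case Er: (repr (Rin p x)) => [q y].
have : Rin q y = Rin p x by rewrite /Rin -Er reprK.
case/Rin_eq => l [l' [h1 h2]].
set d := mulNpos (absdenq _) _.
have dE : (val d)%:Z = denq (g 1 0) * denq (g 1 1).
  by rewrite /d /= PoszM !absz_denq.
clearbody d.
have dn : (denq (g 1 0))%:Q != 0 by rewrite intr_eq0 denq_neq0.
have dn1 : (denq (g 1 1))%:Q != 0 by rewrite intr_eq0 denq_neq0.
have mn : (val m')%:Q != 0 by rewrite intr_eq0; have := valP m'; lia.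
set N := numq (g 1 0) * _; set M := numq (g 1 1) * _.
have dQ : (val d)%:Q = (denq (g 1 0))%:Q * (denq (g 1 1))%:Q.
  by rewrite dE intrM.
have hN : N * val m' = n * val d.
  apply: (intr_inj (R := rat)); rewrite /N !intrM dQ.
  have : (numq (g 1 0))%:Q / (denq (g 1 0))%:Q = n%:Q / (val m')%:Q.
    by rewrite divq_num_den.
  move=> /(congr1 (fun z => z * (denq (g 1 0))%:Q * (val m')%:Q)).
  rewrite divfK // -(mulrA n%:~R) (mulrC _ (denq _)%:~R) mulrA divfK // => e.
  by rewrite mulrAC e; ring.
have hM : M * val m' = m * val d.
  apply: (intr_inj (R := rat)); rewrite /M !intrM dQ.
  have : (numq (g 1 1))%:Q / (denq (g 1 1))%:Q = m%:Q / (val m')%:Q.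
    by rewrite divq_num_den.
  move=> /(congr1 (fun z => z * (denq (g 1 1))%:Q * (val m')%:Q)).
  rewrite divfK // -(mulrA m%:~R) (mulrC _ (denq _)%:~R) mulrA divfK // => e.
  by rewrite mulrAC e; ring.
apply/Rin_eq; exists (mulNpos l m'), (mulNpos l' d); split.
  apply: val_inj; rewrite /= (mulnC (val d) (val q)) mulnACA.
  have -> : (val l * val q = val l' * val p)%N by exact: (congr1 val h1).
  by rewrite (mulnC (val m') (val p)) [RHS]mulnACA (mulnC (val m')).
have h1z : (val l)%:Z * (val q)%:Z = (val l')%:Z * (val p)%:Z.
  by have /(congr1 val) /= := h1; lia.
rewrite !pmulrn !mulrzDl -!mulrzA /=; congr (_ + _).
  have -> : M * (val l * val m')%N = (val l)%:Z * (m * val d).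
    by rewrite -hM PoszM; ring.
  have -> : m * (val l' * val d)%N = (val l')%:Z * (m * val d).
    by rewrite PoszM; ring.
  by rewrite !mulrzA -!pmulrn h2.
congr (_ *~ _); rewrite !PoszM.
transitivity (((val l)%:Z * (val q)%:Z) * (N * val m')); first by ring.
by rewrite h1z hN; ring.
Qed.

Definition Ract (X : Rlim) (g : PQ) : Rlim := lact (g^-1)%g X.

(* A groupoid is recorded as its topological space of arrows with the graphs
   [gmul a b c] (a, b composable and ab = c) of the product and [ginv a b]
   (a^-1 = b) of the inverse. *)
Record groupoid := Groupoid {
  arrows :> topologicalType;
  gmul : arrows -> arrows -> arrows -> Prop;
  ginv : arrows -> arrows -> Prop
}.

Definition topological_groupoid_iso (G H : groupoid) (f : G -> H) : Prop :=
  [/\ bijective f,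
      continuous f /\ (forall V : set G, open V -> open (f @` V)),
      forall a b c : G, gmul a b c <-> gmul (f a) (f b) (f c)
    & forall a b : G, ginv a b <-> ginv (f a) (f b)].

Definition restriction (G : groupoid) (S : set G) : groupoid :=
  @Groupoid (set_type S)
    (fun a b c => gmul (val a : G) (val b) (val c))
    (fun a b => ginv (val a : G) (val b)).

Definition ambient (G : groupoid) (S : set G) (a : restriction S) : G := val a.

Definition transf_groupoid : groupoid :=
  @Groupoid (Rlim * PQ)%type
    (fun a b c => b.1 = Ract a.1 a.2 /\ c = (a.1, (a.2 * b.2)%g))
    (fun a b => b = (Ract a.1 a.2, (a.2^-1)%g)).

Definition RPQ_Zhat : groupoid :=
  @restriction transf_groupoid
    [set a : Rlim * PQ | range embR a.1 /\ range embR (Ract a.1 a.2)].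

Definition germ_groupoid (R : realType) (U : UZ R) : groupoid :=
  @Groupoid (germs U)
    (fun a b c => exists x s t,
       [/\ germ_set a (x, s), germ_set b (ract x s, t)
         & germ_set c (x, s * t)])
    (fun a b => exists x s,
       germ_set a (x, s) /\ germ_set b (ract x s, star s)).

(* The reduction to hatPtight: x and x.s are the range and source of [(x, s)]. *)
Definition tight_groupoid (R : realType) (U : UZ R) : groupoid :=
  @restriction (germ_groupoid U)
    [set a : germs U | exists x s, [/\ germ_set a (x, s),
       ((val : hatP0 U -> Pfun U) @` hatPtight U) x &
       ((val : hatP0 U -> Pfun U) @` hatPtight U) (ract x s)]].

Fact absz_Npos_subproof (m : int) : (0 < if `|m|%N is 0 then 1 else `|m|)%N.
Proof. by case: `|m|%N. Qed.

(* |m| in N+, with junk value 1 at m = 0 *)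
Definition absNpos (m : int) : Npos :=
  exist (fun n => (0 < n)%N) _ (absz_Npos_subproof m).

(* P is the set of the u^n e_m u^-n and 0, and m, n are determined by a nonzero
   element up to the sign of m and n mod m. *)
Definition xi (R : realType) (U : UZ R) (r : Zhat) : Pfun U :=
  fun e => `[< exists m n : int,
    [/\ m != 0, val e = uz_u U n * uz_e U m * uz_u U (- n)
      & ((zcomp r (absNpos m))%:Z = n %[mod m])%Z] >].

Arguments xi {R} U r.

(* Main.v *)
(* Each projection u^n e_m u^-n behaves as the coset n + mZ: the projections of the
   cosets of a fixed m sum to 1, so they are pairwise orthogonal by C*-positivity, and
   products in P become intersections of cosets. A maximal character picks one coset
   for each m, compatibly, i.e. is some xi_r with r in Zhat; this condition is closed,
   so the tight characters are exactly the xi_r.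
   Every element of T has the form q s_m^* u^k s_n with q in P, and its germ at xi_r,
   where xi_r(q) = 1, does not depend on q; since (s_m^* u^k s_n)(s_m^* u^k s_n)^* takes
   the value 1 at xi_r iff m r - k = n t for some t in Zhat, i.e. iff r.g = t is in
   Zhat, phi is well defined and onto. It is one-to-one because an affine map of Q is
   determined by its values on a coset of Z. It is a homeomorphism because the sets of
   r congruent to c mod m form a basis of Zhat, and Zhat is open in the limit R. *)
Require Import Defs.
From mathcomp Require Import all_boot all_order all_algebra.
From mathcomp Require Import generic_quotient complex.
From mathcomp Require Import all_classical all_reals topology.
From mathcomp Require Import zify ring lra.
Import Order.TTheory GRing.Theory Num.Theory.

Set Implicit Arguments.
Unset Strict Implicit.
Unset Printing Implicit Defensive.

Local Open Scope classical_set_scope.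
Local Open Scope ring_scope.

(** * Orthogonality of projections in C*-algebras *)

(** Pairwise orthogonality is the one analytic step. The structure at hand offers the norm and the
    C*-identity, but neither a positive cone nor functional calculus, so convexity stands in for
    positivity: a projection [q] is an extreme point of the unit ball of its corner [q A q].
    Extremality is a numerical-range argument: if [q + x] and [q - x] are contractions, so are all
    powers [(q + (w / 2) x) ^+ N] with [|w| = 1], and averaging over roots of unity isolates the
    linear term, whose norm would grow with [N] unless [x = 0].

    The rest is arithmetic. Conjugation by [u k] and [s l] acts on the predicate [hold] by
    translation and multiplication in [Zhat], so statements about characters become linear equations
    over a torsion-free group. The map [Sg] is not a homomorphism, but it is a partial
    representation of [PQ]: it is multiplicative up to a projection, and a germ does not see a
    projection whose value at its base point is 1. Hence germs multiply and invert as the elements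
    of [PQ] do. *)

Lemma star0 (R : realType) (A : cstarAlgType R) : star (0 : A) = 0.
Proof. by apply: (addrI (star (0 : A))); rewrite -starD !addr0. Qed.

Lemma star1 (R : realType) (A : cstarAlgType R) : star (1 : A) = 1.
Proof. by rewrite -[LHS]mulr1 -{2}[1]starK -starM mulr1 starK. Qed.

Lemma starN (R : realType) (A : cstarAlgType R) (x : A) : star (- x) = - star x.
Proof. by apply: (addrI (star x)); rewrite -starD !subrr star0. Qed.

Lemma cnorm0 (R : realType) (A : cstarAlgType R) : cnorm (0 : A) = 0.
Proof.
have := cnormZ 0 (0 : A); rewrite scaler0 normr0 mul0r => /(congr1 (@complex.Re R)).
by [].
Qed.

Lemma cnormZr (R : realType) (A : cstarAlgType R) (a : R) (x : A) :
  cnorm (a%:C%C *: x) = `|a| * cnorm x.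
Proof.
have := cnormZ a%:C%C x.
by rewrite normc_def /= expr0n addr0 sqrtr_sqr -rmorphM => /(congr1 (@complex.Re R)).
Qed.

Lemma cnormZ1 (R : realType) (A : cstarAlgType R) (a : R[i]) (x : A) :
  `|a| = 1 -> cnorm (a *: x) = cnorm x.
Proof.
by move=> a1; have := cnormZ a x; rewrite a1 mul1r => /(congr1 (@complex.Re R)).
Qed.

Lemma cnormN (R : realType) (A : cstarAlgType R) (x : A) : cnorm (- x) = cnorm x.
Proof. by rewrite -scaleN1r cnormZ1 // normrN1. Qed.

Lemma cnorm_ge0 (R : realType) (A : cstarAlgType R) (x : A) : 0 <= cnorm x.
Proof. by have := cnormD_le x (- x); rewrite subrr cnorm0 cnormN; lra. Qed.

Lemma cnorm_sum_le (R : realType) (A : cstarAlgType R) (I : Type) (r : seq I)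
    (P : pred I) (F : I -> A) :
  cnorm (\sum_(i <- r | P i) F i) <= \sum_(i <- r | P i) cnorm (F i).
Proof.
elim/big_rec2: _ => [|i y x _ h]; first by rewrite cnorm0.
exact: le_trans (cnormD_le _ _) (lerD _ h).
Qed.

Lemma cnormX_le1 (R : realType) (A : cstarAlgType R) (x : A) n :
  (0 < n)%N -> cnorm x <= 1 -> cnorm (x ^+ n) <= 1.
Proof.
case: n => // n _ h; elim: n => [|n ih]; first by rewrite expr1.
by rewrite exprS (le_trans (cnormM_le _ _)) // mulr_ile1 ?cnorm_ge0.
Qed.

Lemma star_mul_eq0 (R : realType) (A : cstarAlgType R) (x : A) :
  star x * x = 0 -> x = 0.
Proof.
move=> h; apply: cnorm0_eq0; apply/eqP; rewrite -sqrf_eq0.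
by rewrite -cstar_identity h cnorm0.
Qed.

Lemma cnorm_proj_le1 (R : realType) (A : cstarAlgType R) (p : A) :
  star p = p -> p * p = p -> cnorm p <= 1.
Proof.
move=> sp pp; have := cstar_identity p; rewrite sp pp => h.
have := cnorm_ge0 p; nra.
Qed.

Lemma cnorm_add_scale_le1 (R : realType) (A : cstarAlgType R) (p x : A) (t : R) :
  cnorm (p + x) <= 1 -> cnorm (p - x) <= 1 -> `|t| <= 1 ->
  cnorm (p + t%:C%C *: x) <= 1.
Proof.
move=> h1 h2 ht.
have -> : p + t%:C%C *: x = ((1 + t) / 2)%:C%C *: (p + x)
    + ((1 - t) / 2)%:C%C *: (p - x).
  rewrite !scalerDr scalerN addrACA -scalerDl -scalerBl -rmorphD -rmorphB.
  have -> : (1 + t) / 2 + (1 - t) / 2 = 1 by field.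
  have -> : (1 + t) / 2 - (1 - t) / 2 = t by field.
  by rewrite scale1r.
rewrite (le_trans (cnormD_le _ _)) // !cnormZr.
have [t1 t2] : -1 <= t /\ t <= 1 by move: ht; rewrite ler_norml => /andP.
rewrite !ger0_norm; [|lra|lra].
have := cnorm_ge0 (p + x); have := cnorm_ge0 (p - x); nra.
Qed.

Lemma sqrD_proj (S : pzRingType) (p x : S) :
  p * p = p -> p * x = x -> x * p = x ->
  (p + x) * (p + x) = (p + x * x) + (x + x).
Proof.
move=> pp px xp; rewrite !mulrDl !mulrDr pp px xp.
by rewrite (AC (2*2) ((1*4)*(2*3))).
Qed.

(** For [c = i] or [c = -i] the C*-identity reduces [p + c x] to [p + x * x], the mean of the
    squares of [p + x] and [p - x]. With [w = a + b i], the element [p + (w / 2) x] is the mean of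
    [p + a x] and [p + b i x], both contractions by convexity; the factor 1/2 comes from this
    mean. *)
Lemma cnorm_add_unit_le1 (R : realType) (A : cstarAlgType R) (p x : A) (w : R[i]) :
  star p = p -> p * p = p -> star x = x -> p * x = x -> x * p = x ->
  cnorm (p + x) <= 1 -> cnorm (p - x) <= 1 -> `|w| = 1 ->
  cnorm (p + (w / 2) *: x) <= 1.
Proof.
move=> sp pp sx px xp h1 h2 w1.
have p1 := cnorm_proj_le1 sp pp.
have sq : (1/2)%:C%C *: ((p + x) * (p + x) + (p - x) * (p - x)) = p + x * x.
  rewrite (sqrD_proj pp px xp) (@sqrD_proj _ _ (- x)) ?mulrN ?mulNr ?px ?xp //.
  rewrite opprK addrACA -opprD subrr addr0 scalerDr -scalerDl -rmorphD.
  by rewrite (_ : 1/2 + 1/2 = 1 :> R) ?scale1r //; field.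
have h3 : cnorm (p + x * x) <= 1.
  rewrite -sq cnormZr ger0_norm; last by lra.
  have := cnormD_le ((p + x) * (p + x)) ((p - x) * (p - x)).
  have := cnormM_le (p + x) (p + x); have := cnormM_le (p - x) (p - x).
  have := cnorm_ge0 (p + x); have := cnorm_ge0 (p - x); nra.
have hi (c : R[i]) : c * c = -1 -> Num.conj c = - c -> cnorm (p + c *: x) <= 1.
  move=> cc cs; have := cstar_identity (p + c *: x).
  rewrite starD sp starZ sx cs scaleNr mulrDl !mulrDr !mulNr.
  rewrite -!scalerAr -!scalerAl pp px xp scalerA cc scaleN1r opprK addrA addrK.
  move=> h; have := cnorm_ge0 (p + c *: x); nra.
have ii : 'i%C * 'i%C = -1 :> R[i] by rewrite -expr2 sqr_i.
have ic : Num.conj ('i%C : R[i]) = - 'i%C.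
  by apply/eqP; rewrite eq_complex /= oppr0 !eqxx.
have i1 : cnorm (p + 'i%C *: x) <= 1 by apply: hi.
have i2 : cnorm (p - 'i%C *: x) <= 1.
  by rewrite -scaleNr; apply: hi; rewrite ?mulrNN // rmorphN /= ic.
case: w w1 => a b w1.
have ab : a ^+ 2 + b ^+ 2 = 1.
  move: w1; rewrite normc_def /= => /(congr1 (@complex.Re R)) /= w1.
  by rewrite -[LHS]sqr_sqrtr ?w1 ?expr1n // addr_ge0 // sqr_ge0.
have -> : p + ((a +i* b)%C / 2) *: x
    = (1/2)%:C%C *: ((p + a%:C%C *: x) + (p + b%:C%C *: ('i%C *: x))).
  rewrite addrACA scalerDr (scalerDr _ (a%:C%C *: x)) !scalerA -!scalerDl.
  rewrite -[p + p]/(p *+ 2) -[p *+ 2]scaler_nat scalerA; congr (_ + _).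
    rewrite -(rmorph_nat (real_complex R)) -rmorphM divfK ?pnatr_eq0 //.
    by rewrite scale1r.
  congr (_ *: _); rewrite -mulrA -mulrDr mulrC; congr (_ * _).
    by rewrite -(rmorph_nat (real_complex R)) -fmorphV div1r.
  by simpc.
rewrite cnormZr ger0_norm; last by lra.
have := @cnorm_add_scale_le1 _ _ p x a h1 h2.
have := @cnorm_add_scale_le1 _ _ p _ b i1 i2.
have := cnormD_le (p + a%:C%C *: x) (p + b%:C%C *: ('i%C *: x)).
have a1 : `|a| <= 1 by rewrite ler_norml; apply/andP; split; nra.
have b1 : `|b| <= 1 by rewrite ler_norml; apply/andP; split; nra.
move=> h /(_ b1) hb /(_ a1) ha; lra.
Qed.

(** A [2 ^ k]-th root of -1 has order dividing [2 ^ k.+1] but not [2 ^ k], which for a prime power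
    leaves only [2 ^ k.+1]. The averaging below only asks for arbitrarily large orders. *)
Lemma prim_root_2expn_exists (C : numClosedFieldType) k :
  exists z : C, (2 ^ k.+1)%N.-primitive_root z.
Proof.
have k_gt0 : (0 < 2 ^ k)%N by rewrite expn_gt0.
pose z : C := (2 ^ k)%N.-root (-1).
have zk : z ^+ (2 ^ k) = -1 by rewrite rootCK.
have [m zm] : {m | m.-primitive_root z & (m %| 2 ^ k.+1)%N}.
  by apply: prim_order_exists; rewrite ?expn_gt0 // expnSr exprM zk sqrrN expr1n.
case/(dvdn_pfactor _ _ (isT : prime 2)) => i ik mE.
have : ~~ (m %| 2 ^ k)%N.
  by rewrite (prim_order_dvd zm) zk eq_sym -addr_eq0 -(natrD _ 1 1) pnatr_eq0.
rewrite mE dvdn_Pexp2l // -ltnNge => ki.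
by exists z; rewrite (_ : k.+1 = i) -?mE //; apply/eqP; rewrite eqn_leq ki.
Qed.

Lemma sum_prim_root_eq0 (F : fieldType) (z : F) n k :
  n.-primitive_root z -> ~~ (n %| k)%N -> \sum_(j < n) z ^+ (j * k) = 0.
Proof.
move=> zn nk; have zk : z ^+ k - 1 != 0 by rewrite subr_eq0 -(prim_order_dvd zn).
apply: (mulfI zk); rewrite mulr0.
under eq_bigr do rewrite mulnC exprM.
by rewrite -subrX1 -exprM mulnC exprM (prim_expr_order zn) expr1n subrr.
Qed.

(* Average [w^-1 (p + (w / 2) x)^N] over the (N + 1)-th roots of unity [w]: only
   the linear term [(N / 2) x] of the binomial expansion survives. *)
Lemma cnorm_proj_extreme_bound (R : realType) (A : cstarAlgType R) (p x : A) k :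
  star p = p -> p * p = p -> star x = x -> p * x = x -> x * p = x ->
  cnorm (p + x) <= 1 -> cnorm (p - x) <= 1 -> k%:R * cnorm x <= 2.
Proof.
move=> sp pp sx px xp h1 h2.
have [z zM] := prim_root_2expn_exists (R[i]) k.
have [N NE] : exists N, (2 ^ k.+1 = N.+1)%N.
  by exists (2 ^ k.+1).-1; rewrite prednK // expn_gt0.
rewrite NE in zM.
have kN : (k < N)%N by rewrite -ltnS -NE; exact: ltn_expl.
have N_gt0 : (0 < N)%N by exact: leq_ltn_trans kN.
have znorm : `|z| = 1.
  by apply/eqP; rewrite -(@pexpr_eq1 _ _ N.+1) // -normrX (prim_expr_order zM) normr1.
have pX n : p ^+ n * x = x.
  by elim: n => [|n ih]; rewrite ?mul1r // exprS -mulrA ih px.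
have expand : \sum_(j < N.+1) (z ^+ j) ^+ N *: (p + (z ^+ j / 2) *: x) ^+ N
    = (N.+1%:R * (N%:R / 2)) *: x.
  transitivity (\sum_(i < N.+1) ((\sum_(j < N.+1) z ^+ (j * (N + i))) *
      (2^-1 ^+ i * 'C(N, i)%:R)) *: (p ^+ (N - i) * x ^+ i)).
    under [RHS]eq_bigr do rewrite mulr_suml scaler_suml.
    rewrite [RHS]exchange_big; apply: eq_bigr => j _ /=.
    rewrite exprDn_comm; last by rewrite /GRing.comm -scalerAr -scalerAl px xp.
    rewrite scaler_sumr; apply: eq_bigr => i _.
    rewrite exprZn -scalerAr -scaler_nat !scalerA; congr (_ *: _).
    rewrite !exprMn mulnDr exprD !exprM -!mulrA; congr (_ * _).
    by rewrite mulrC mulrA.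
  (* For [0 <= i <= N] the exponent [N + i] is a multiple of [N.+1] only at [i = 1]; elsewhere the
     sum over the roots of unity vanishes. *)
  rewrite (bigD1 (Ordinal (N_gt0 : 1 < N.+1)%N)) //= addn1.
  rewrite [X in _ + X]big1 ?addr0 => [|i i1].
    under eq_bigr do rewrite mulnC exprM (prim_expr_order zM) expr1n.
    rewrite sumr_const card_ord bin1 expr1 (mulrC 2^-1).
    by rewrite pX.
  rewrite sum_prim_root_eq0 ?mul0r ?scale0r //; apply/negP => /dvdnP[q qE].
  have := ltn_ord i; have : i <> 1%N :> nat by move=> e; case/eqP: i1; apply: val_inj.
  case: q qE => [|[|q]]; lia.
have bound : cnorm ((N.+1%:R * (N%:R / 2)) *: x) <= N.+1%:R.
  rewrite -expand (le_trans (cnorm_sum_le _ _ _)) //.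
  rewrite -[leRHS]mulr_natl mulr1 -[X in _ <= X%:R]card_ord -sumr_const.
  apply: ler_sum => j _; have zj : `|z ^+ j| = 1 by rewrite normrX znorm expr1n.
  rewrite cnormZ1 ?(normrX _ (_ ^+ _)) ?zj ?expr1n //; apply: cnormX_le1 => //.
  exact: cnorm_add_unit_le1.
move: bound; rewrite (_ : N.+1%:R * (N%:R / 2) = (N.+1%:R * (N%:R / 2))%:C%C); last first.
  by rewrite !rmorphM fmorphV !rmorph_nat.
rewrite cnormZr ger0_norm ?mulr_ge0 ?invr_ge0 ?ler0n // -mulrA.
rewrite ger_pMr ?ltr0n // => h.
have kNR : k%:R <= N%:R :> R by rewrite ler_nat ltnW.
have := cnorm_ge0 x; nra.
Qed.

(** The bound holds for every [k] while the norm of [x] is fixed, so the Archimedean property forces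
    [x = 0]. *)
Lemma cnorm_proj_extreme (R : realType) (A : cstarAlgType R) (p x : A) :
  star p = p -> p * p = p -> star x = x -> p * x = x -> x * p = x ->
  cnorm (p + x) <= 1 -> cnorm (p - x) <= 1 -> x = 0.
Proof.
move=> sp pp sx px xp h1 h2; apply: cnorm0_eq0; apply/eqP; rewrite eq_le cnorm_ge0 andbT.
rewrite leNgt; apply/negP => x_gt0.
have := cnorm_proj_extreme_bound (Num.bound (2 / cnorm x)) sp pp sx px xp h1 h2.
rewrite leNgt -ltr_pdivrMr // => /negP[].
by rewrite archi_boundP // divr_ge0 ?ltW.
Qed.

(* With [q := p_j] and [h_i := q p_i q], the [h_i] for [i != j] sum to [0] while each
   [q - h_i] is a contraction, so both [q + t h_i] and [q - t h_i] are contractions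
   for small [t > 0], and [q] is an extreme point of the unit ball of its corner. *)
Lemma proj_sum1_orthogonal (R : realType) (A : cstarAlgType R) (I : finType)
    (p : I -> A) :
  (forall i, star (p i) = p i) -> (forall i, p i * p i = p i) ->
  \sum_i p i = 1 -> forall i j, i != j -> p i * p j = 0.
Proof.
move=> sp pp sum1 i j ij.
pose q := p j; pose h l := q * p l * q.
have hq l : q * h l = h l by rewrite /h !mulrA pp.
have qh l : h l * q = h l by rewrite /h -!mulrA pp.
have sh l : star (h l) = h l by rewrite /h !starM !sp mulrA.
have nh l : cnorm (q - h l) <= 1.
  have -> : q - h l = q * (1 - p l) * q by rewrite mulrBr mulrBl mulr1 pp.
  have q1 : cnorm q <= 1 := cnorm_proj_le1 (sp j) (pp j).
  have p1 : cnorm (1 - p l) <= 1.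
    apply: cnorm_proj_le1; first by rewrite starD starN star1 sp.
    by rewrite mulrBr mulr1 mulrBl mul1r pp subrr subr0.
  have := cnormM_le (q * (1 - p l)) q; have := cnormM_le q (1 - p l).
  have := cnorm_ge0 q; have := cnorm_ge0 (1 - p l).
  have := cnorm_ge0 (q * (1 - p l)); nra.
have sum0 : \sum_(l | l != j) h l = 0.
  apply: (addrI (h j)); rewrite addr0.
  transitivity (\sum_l h l); first by rewrite [RHS](bigD1 j).
  by rewrite /h -mulr_suml -mulr_sumr sum1 mulr1 !pp.
pose c := #|[pred l | (l != j) && (l != i)]|.
have cE : \sum_(l | (l != j) && (l != i)) (q - h l) = q *+ c + h i.
  rewrite big_split /= sumr_const sumrN; congr (_ + _).
  apply/esym/eqP; rewrite -addr_eq0; apply/eqP.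
  transitivity (\sum_(l | l != j) h l); last exact: sum0.
  by rewrite [RHS](bigD1 i).
have c0 : (0 : R) <= c%:R by exact: ler0n.
have q_le1 : cnorm q <= 1 := cnorm_proj_le1 (sp j) (pp j).
(* This value makes [q + t h_i] the mean of the [c + 1] contractions [q] and [q - h_l] ([l] other
   than [i], [j]), while [q - t h_i] is a convex combination of [q] and [q - h_i]. *)
pose t : R := (c%:R + 1)^-1.
have t0 : 0 < t by rewrite invr_gt0; lra.
have tc : t * (c%:R + 1) = 1 by rewrite mulVf // gt_eqF //; lra.
have y0 : t%:C%C *: h i = 0.
  apply: (@cnorm_proj_extreme _ _ q _ (sp j) (pp j)).
  - by rewrite starZ sh; congr (_ *: _); apply/eqP; rewrite eq_complex /= oppr0 !eqxx.
  - by rewrite -scalerAr hq.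
  - by rewrite -scalerAl qh.
  - have -> : q + t%:C%C *: h i
        = t%:C%C *: (q + \sum_(l | (l != j) && (l != i)) (q - h l)).
      rewrite cE addrA -mulrS scalerDr; congr (_ + _).
      rewrite -scaler_nat scalerA -(rmorph_nat (real_complex R)) -rmorphM /=.
      by rewrite -natr1 tc scale1r.
    rewrite cnormZr gtr0_norm //.
    have h1 := cnormD_le q (\sum_(l | (l != j) && (l != i)) (q - h l)).
    have h2 : cnorm (\sum_(l | (l != j) && (l != i)) (q - h l)) <= c%:R.
      rewrite (le_trans (cnorm_sum_le _ _ _)) // /c -sumr_const.
      by apply: ler_sum => l _.
    nra.
  - have -> : q - t%:C%C *: h i = (t * c%:R)%:C%C *: q + t%:C%C *: (q - h i).
      rewrite scalerBr addrA -scalerDl -rmorphD /=.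
      have -> : t * c%:R + t = 1 by move: tc; rewrite mulrDr mulr1.
      by rewrite scale1r.
    rewrite (le_trans (cnormD_le _ _)) // !cnormZr !ger0_norm ?mulr_ge0 ?(ltW t0) //.
    have h3 : t * c%:R * cnorm q <= t * c%:R by rewrite ler_piMr // mulr_ge0 // ltW.
    have h4 : t * cnorm (q - h i) <= t by rewrite ler_piMr // ltW.
    by move: tc; rewrite mulrDr mulr1; lra.
have hi0 : h i = 0.
  move/eqP: y0; rewrite scaler_eq0 => /orP[|/eqP//].
  by rewrite eq_complex /= gt_eqF.
(* [h i] is [star x * x] for [x = p i * p j]. *)
by apply: star_mul_eq0; rewrite starM !sp mulrA -(mulrA (p j)) pp.
Qed.

(** * Congruences in the profinite integers *)

Lemma eqz_modP (m a b : int) :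
  (a = b %[mod m])%Z <-> exists k, a = b + k * m.
Proof.
split=> [/eqP|[k ->]]; last by rewrite addrC modzMDl.
by rewrite eqz_mod_dvd => /dvdzP[k e]; exists k; rewrite -e addrC subrK.
Qed.

Lemma absNposE (m : int) : m != 0 -> val (absNpos m) = `|m|%N.
Proof. by rewrite -absz_eq0 /=; case: `|m|%N. Qed.

Lemma zcompD (r t : Zhat) k :
  zcomp (r + t) k = ((zcomp r k + zcomp t k) %% val k)%N :> nat.
Proof. by []. Qed.

Lemma zcompMn (r : Zhat) l k :
  zcomp (r *+ l) k = ((zcomp r k * l) %% val k)%N :> nat.
Proof.
elim: l => [|l ih]; first by rewrite muln0.
by rewrite mulrS zcompD ih modnDmr mulnS.
Qed.

Lemma zcompDz (r t : Zhat) k :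
  ((zcomp (r + t) k)%:Z = (zcomp r k)%:Z + (zcomp t k)%:Z %[mod val k])%Z.
Proof. by rewrite zcompD -PoszD !modz_nat modn_mod. Qed.

Lemma zcompN (r : Zhat) k :
  ((zcomp (- r) k)%:Z = - (zcomp r k)%:Z %[mod val k])%Z.
Proof.
apply/eqP; rewrite eqz_mod_dvd opprK.
have := zcompDz (- r) r k; rewrite addNr [zcomp 0 k : nat]mod0n => /esym/eqP.
by rewrite eqz_mod_dvd subr0.
Qed.

Lemma zcompZ (r : Zhat) (c : int) k :
  ((zcomp (r *~ c) k)%:Z = (zcomp r k)%:Z * c %[mod val k])%Z.
Proof.
have nat_case l : ((zcomp (r *+ l) k)%:Z = (zcomp r k)%:Z * l%:Z %[mod val k])%Z.
  by rewrite zcompMn -PoszM !modz_nat modn_mod.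
case: c => l; first exact: nat_case.
rewrite NegzE mulrNz mulrN zcompN.
by apply/eqP; rewrite eqz_mod_dvd opprK addrC -eqz_mod_dvd; apply/eqP/esym/nat_case.
Qed.

(** The component of [t *+ M] at level [k * M] determines that of [t] modulo [k]. So [Zhat] is
    torsion-free although its finite quotients are not. *)
Lemma Zhat_mulrnI (M : nat) : (0 < M)%N -> injective (fun t : Zhat => t *+ M).
Proof.
move=> M0 t t' /= h; apply: Zhat_eq => k.
pose M' : Npos := exist _ M M0.
have : zcomp (t *+ M) (mulNpos k M') = zcomp (t' *+ M) (mulNpos k M') :> nat.
  by rewrite h.
rewrite !zcompMn /= -!muln_modl // => /eqP; rewrite eqn_pmul2r // => /eqP.
by rewrite !zcompP !modn_small.
Qed.

Lemma Zhat_mulrzI (m : int) : m != 0 -> injective (fun t : Zhat => t *~ m).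
Proof.
move=> m0 t t'; case: m m0 => M M0 /=.
  by apply: Zhat_mulrnI; lia.
by rewrite NegzE !mulrNz => /oppr_inj; apply: Zhat_mulrnI.
Qed.

(** Division by [M] costs a factor [M] of the modulus, so the quotient modulo [k] is read off the
    component of [r] at level [M * k]. *)
Lemma Zhat_div_ex (r : Zhat) (M : Npos) :
  zcomp r M = 0%N :> nat -> exists t, r = t *+ val M.
Proof.
move=> rM.
have dvd k : (val M %| zcomp r (mulNpos M k))%N by rewrite /dvdn zcompP rM mod0n.
pose f k := (zcomp r (mulNpos M k) %/ val M)%N.
have fE k : (f k * val M = zcomp r (mulNpos M k))%N by rewrite divnK.
have fP m k : f (mulNpos m k) = f m %[mod val m].
  have M0 := valP M.
  apply/eqP; rewrite -(eqn_pmul2r M0) !muln_modl // !fE; apply/eqP.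
  by rewrite (mulNposA M) [(val m * val M)%N]mulnC zcompP.
exists (Zhat_mk fP); apply: Zhat_eq => k.
rewrite zcompMn zcomp_mk modnMml fE mulNposC zcompP modn_small //.
Qed.

Definition zcong (r : Zhat) (m n : int) : Prop :=
  ((zcomp r (absNpos m))%:Z = n %[mod m])%Z.

Lemma zcomp_int (c : int) k :
  ((zcomp (Zhat_one *~ c) k)%:Z = c %[mod val k])%Z.
Proof.
rewrite zcompZ [zcomp Zhat_one k : nat]zcomp_mk -modzMml modz_nat modn_mod -modz_nat.
by rewrite modzMml mul1r.
Qed.

Lemma eqmodz_abs (m a b : int) :
  (a = b %[mod `|m|%N])%Z <-> (a = b %[mod m])%Z.
Proof. by split=> /eqP h; apply/eqP; move: h; rewrite !eqz_mod_dvd !dvdzE. Qed.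

(** Replaces the congruence by membership in [n + m Zhat]; the later rules then follow by computing
    in the group [Zhat]. The sign of [m] is absorbed in [t]. *)
Lemma zcongP (r : Zhat) (m n : int) : m != 0 ->
  zcong r m n <-> exists t, r = Zhat_one *~ n + t *~ m.
Proof.
move=> m0; have ME := absNposE m0; rewrite /zcong.
set M := absNpos m in ME *; clearbody M.
have EE a b : (a = b %[mod val M])%Z <-> (a = b %[mod m])%Z.
  by rewrite ME eqmodz_abs.
split=> [/EE/eqz_modP[k1 h1]|[t ->]]; last first.
  apply/EE/eqz_modP.
  have /eqz_modP[k1 ->] := zcompDz (Zhat_one *~ n) (t *~ m) M.
  have /eqz_modP[k2 ->] := zcomp_int n M.
  have /eqz_modP[k3 ->] := zcompZ t m M.
  have /dvdzP[k4 mE] : ((val M)%:Z %| m)%Z by rewrite dvdzE ME.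
  by exists (k1 + k2 + k3 + (zcomp t M)%:Z * k4); move: mE => ->; ring.
have [t rt] : exists t, r - Zhat_one *~ n = t *+ val M.
  apply: Zhat_div_ex.
  have /eqz_modP[k2 h2] := zcompDz r (- (Zhat_one *~ n)) M.
  have /eqz_modP[k3 h3] := zcompN (Zhat_one *~ n) M.
  have /eqz_modP[k4 h4] := zcomp_int n M.
  have : ((zcomp (r - Zhat_one *~ n) M)%:Z = 0 %[mod val M])%Z.
    apply/eqz_modP; exists (k1 + k2 + k3 - k4).
    by rewrite h2 h1 h3 h4; ring.
  by rewrite mod0z modz_nat modn_small // => -[].
exists (t *~ sgz m); rewrite -mulrzA.
have -> : sgz m * m = (val M)%:Z by rewrite ME; lia.
by rewrite -pmulrn -rt addrC subrK.
Qed.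

Lemma zcong_ex (r : Zhat) (m : int) : exists c, zcong r m c.
Proof. by exists (zcomp r (absNpos m))%:Z. Qed.

Lemma zcong_eqmod (r : Zhat) (m n n' : int) :
  zcong r m n -> (zcong r m n' <-> (n = n' %[mod m])%Z).
Proof. by rewrite /zcong => ->. Qed.

Lemma zcong_int (c m n : int) : m != 0 ->
  zcong (Zhat_one *~ c) m n <-> (c = n %[mod m])%Z.
Proof.
move=> m0; apply: zcong_eqmod; apply/(zcongP _ _ m0).
by exists 0; rewrite mul0rz addr0.
Qed.

Lemma zcong_dvd (r : Zhat) (m k n : int) : m * k != 0 ->
  zcong r (m * k) n -> zcong r m n.
Proof.
move=> mk; have m0 : m != 0 by move: mk; rewrite mulf_eq0 negb_or => /andP[].
move=> /(zcongP _ _ mk)[t ->]; apply/(zcongP _ _ m0).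
by exists (t *~ k); rewrite -mulrzA (mulrC k).
Qed.

Lemma zcongZ (r : Zhat) (l m n : int) : l != 0 -> m != 0 ->
  zcong (r *~ l) (l * m) (l * n) <-> zcong r m n.
Proof.
move=> l0 m0; have lm : l * m != 0 by rewrite mulf_neq0.
split=> [/(zcongP _ _ lm)|/(zcongP _ _ m0)] [t e].
  apply/(zcongP _ _ m0); exists t; apply: (Zhat_mulrzI l0).
  by rewrite e mulrzDl -!mulrzA !(mulrC l).
apply/(zcongP _ _ lm); exists t.
by rewrite e mulrzDl -!mulrzA !(mulrC l).
Qed.

(** Membership in [l n + l m Zhat] already forces divisibility by [l]. This is the arithmetic side
    of conjugation by [s l]. *)
Lemma zcong_divP (r : Zhat) (l m n : int) : l != 0 -> m != 0 ->
  zcong r (l * m) (l * n) <-> exists2 t, r = t *~ l & zcong t m n.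
Proof.
move=> l0 m0; have lm : l * m != 0 by rewrite mulf_neq0.
split=> [/(zcongP _ _ lm)[t e]|[t -> h]]; last exact/zcongZ.
exists (Zhat_one *~ n + t *~ m); first by rewrite e mulrzDl -!mulrzA !(mulrC l).
by apply/(zcongP _ _ m0); exists t.
Qed.

Lemma zcongDz (r : Zhat) (k m n : int) : m != 0 ->
  zcong (r + Zhat_one *~ k) m (n + k) <-> zcong r m n.
Proof.
move=> m0; split=> /(zcongP _ _ m0)[t e]; apply/(zcongP _ _ m0); exists t.
  by apply: (addIr (Zhat_one *~ k)); rewrite e mulrzDr addrAC.
by rewrite e mulrzDr addrAC.
Qed.

Lemma Zhat_eq_zcong (r t : Zhat) :
  (forall m n, m != 0 -> zcong r m n -> zcong t m n) -> r = t.
Proof.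
move=> h; apply: Zhat_eq => k; have k0 := valP k.
have kk : absNpos (val k)%:Z = k by apply: val_inj; rewrite absNposE //; lia.
have := h (val k)%:Z (zcomp r k)%:Z; rewrite /zcong kk => /(_ _ erefl).
by rewrite !modz_nat !modn_small // ; lia.
Qed.

(** * The semilattice P *)

Lemma uz_u0 (R : realType) (U : UZ R) : uz_u U 0 = 1.
Proof.
have [h _] := uz_unitary (uz_rel U) 0.
by rewrite -[LHS]mul1r -h -mulrA (uz_uD (uz_rel U)) addr0 h.
Qed.

Lemma uz_uMN (R : realType) (U : UZ R) n : uz_u U n * uz_u U (- n) = 1.
Proof. by rewrite (uz_uD (uz_rel U)) subrr uz_u0. Qed.

Lemma uz_uNM (R : realType) (U : UZ R) n : uz_u U (- n) * uz_u U n = 1.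
Proof. by rewrite (uz_uD (uz_rel U)) addNr uz_u0. Qed.

Lemma star_uz_u (R : realType) (U : UZ R) n : star (uz_u U n) = uz_u U (- n).
Proof.
have [h _] := uz_unitary (uz_rel U) n.
by rewrite -[RHS]mul1r -h -mulrA uz_uMN mulr1.
Qed.

Lemma uz_us (R : realType) (U : UZ R) m n : m != 0 ->
  uz_u U n * star (uz_s U m) = star (uz_s U m) * uz_u U (m * n).
Proof.
move=> m0; apply: (can_inj (@starK R U)); rewrite !starM !starK !star_uz_u.
by rewrite -mulrN (uz_su (uz_rel U)).
Qed.

Lemma star_uz_sM (R : realType) (U : UZ R) m n : m != 0 -> n != 0 ->
  star (uz_s U m) * star (uz_s U n) = star (uz_s U (m * n)).
Proof. by move=> m0 n0; rewrite -starM (uz_sM (uz_rel U)) // mulrC. Qed.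

Definition pj (R : realType) (U : UZ R) (m n : int) : U :=
  uz_u U n * uz_e U m * uz_u U (- n).

Section Pj.
Variables (R : realType) (U : UZ R).
Implicit Types (m n k l c : int) (p q : U).
Local Notation u := (uz_u U).
Local Notation s := (uz_s U).
Local Notation pj := (pj U).
Let rel := uz_rel U.

Lemma uz_ss m : m != 0 -> star (s m) * s m = 1.
Proof. exact: (uz_isometry rel). Qed.

Lemma star_uz_e m : star (uz_e U m) = uz_e U m.
Proof. by rewrite /uz_e starM starK. Qed.

Lemma star_pj m n : star (pj m n) = pj m n.
Proof. by rewrite /pj 2!starM !star_uz_u star_uz_e opprK mulrA. Qed.

Lemma pjE m n : pj m n = (u n * s m) * star (u n * s m).
Proof. by rewrite starM star_uz_u /pj /uz_e !mulrA. Qed.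

Lemma star_us_us m n : m != 0 -> star (u n * s m) * (u n * s m) = 1.
Proof.
move=> m0; rewrite starM star_uz_u mulrA -(mulrA (star _)) uz_uNM mulr1.
exact: uz_ss.
Qed.

Lemma pjK m n : m != 0 -> pj m n * pj m n = pj m n.
Proof. by move=> m0; rewrite pjE mulrA -(mulrA (u n * s m)) star_us_us // mulr1. Qed.

Lemma pj_neq0 m n : m != 0 -> pj m n != 0.
Proof.
move=> m0; apply/eqP => h; have /eqP := oner_neq0 U; apply.
rewrite -(star_us_us n m0) -[LHS]mulr1 -(star_us_us n m0).
by rewrite -mulrA (mulrA (u n * s m)) -pjE h mul0r mulr0.
Qed.

Lemma uz_e_uM m k : m != 0 -> u (m * k) * uz_e U m = uz_e U m * u (m * k).
Proof.
by move=> m0; rewrite /uz_e mulrA -(uz_su rel) // -!mulrA uz_us.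
Qed.

Lemma pj_eqmod m n n' : m != 0 -> (n = n' %[mod m])%Z -> pj m n = pj m n'.
Proof.
move=> m0 /eqz_modP[k ->]; have := uz_e_uM k m0.
rewrite /pj -(uz_uD rel) (mulrC k); set e := uz_e U m; clearbody e => h.
rewrite -!mulrA (mulrA (u (m * k))) h -!mulrA (uz_uD rel).
by congr (_ * (_ * u _)); ring.
Qed.

Lemma pj_sum1 m : m != 0 -> \sum_(c < `|m|%N) pj m c%:Z = 1.
Proof. exact: (uz_sum rel). Qed.

Lemma pj_orth m n n' : m != 0 -> (n != n' %[mod m])%Z -> pj m n * pj m n' = 0.
Proof.
move=> m0 nn'.
have lt a : (`|(a %% m)%Z| < `|m|)%N.
  by have := modz_ge0 a m0; have := ltz_mod a m0; lia.
have red a : pj m a = pj m (Ordinal (lt a) : nat)%:Z.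
  by apply: pj_eqmod => //=; rewrite gez0_abs ?modz_mod // modz_ge0.
rewrite (red n) (red n').
apply: (@proj_sum1_orthogonal _ _ _ (fun i : 'I_`|m|%N => pj m (i : nat)%:Z)).
- by move=> i; rewrite star_pj.
- by move=> i; rewrite pjK.
- exact: pj_sum1.
apply: contra nn' => /eqP/(congr1 val) /= h; apply/eqP.
by have := modz_ge0 n m0; have := modz_ge0 n' m0; lia.
Qed.

Lemma us_mul m k n n' : m != 0 -> k != 0 ->
  u n * s m * (u n' * s k) = u (n + m * n') * s (m * k).
Proof.
move=> m0 k0; rewrite mulrA -(mulrA (u n)) (uz_su rel) // mulrA (uz_uD rel).
by rewrite -mulrA (uz_sM rel).
Qed.

Lemma pj_conj m n k c : m != 0 -> k != 0 ->
  u n * s m * pj k c * star (u n * s m) = pj (m * k) (n + m * c).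
Proof.
move=> m0 k0; rewrite !pjE mulrA us_mul // -mulrA -starM.
by rewrite us_mul.
Qed.

(** [pj (m * k) c] is the conjugate of [pj k 0] by the isometry [u c * s m], whose range projection
    is [pj m c]. So it lies below [pj m c], and [pj m n] either equals that projection or is
    orthogonal to it. *)
Lemma pj_mul_sub m k n c : m != 0 -> k != 0 ->
  pj m n * pj (m * k) c = if (c == n %[mod m])%Z then pj (m * k) c else 0.
Proof.
move=> m0 k0.
have -> : pj (m * k) c = pj m c * pj (m * k) c.
  have := pj_conj c 0 m0 k0; rewrite mulr0 addr0 => <-.
  have := star_us_us c m0; rewrite (pjE m c); move: (u c * s m) => X XX.
  by rewrite !mulrA -(mulrA X (star X)) XX mulr1.
rewrite mulrA; case: ifP => [/eqP e|/negbT e].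
  by rewrite (pj_eqmod m0 e) pjK.
by rewrite pj_orth ?mul0r // eq_sym.
Qed.

Lemma pj_mul_subr m k n c : m != 0 -> k != 0 ->
  pj (m * k) c * pj m n = if (c == n %[mod m])%Z then pj (m * k) c else 0.
Proof.
move=> m0 k0; apply: (can_inj (@starK R U)); rewrite starM !star_pj pj_mul_sub //.
by case: ifP; rewrite ?star_pj ?star0.
Qed.

Lemma pj_expand m k n : m != 0 -> k != 0 ->
  pj m n = \sum_(c < absz (m * k) | ((c : nat)%:Z == n %[mod m])%Z)
    pj (m * k) (c : nat)%:Z.
Proof.
move=> m0 k0; rewrite -[LHS]mulr1 -(pj_sum1 (mulf_neq0 m0 k0)) mulr_sumr.
rewrite [RHS]big_mkcond; apply: eq_bigr => c _.
by rewrite pj_mul_sub.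
Qed.

Lemma pj_mul m m' n n' : m != 0 -> m' != 0 -> let L := lcmz m m' in
  pj m n * pj m' n' = \sum_(c < `|L|%N | ((c : nat)%:Z == n %[mod m])%Z &&
    ((c : nat)%:Z == n' %[mod m'])%Z) pj L (c : nat)%:Z.
Proof.
move=> m0 m0' L.
have L0 : L != 0 by rewrite lcmz_neq0 m0.
have /dvdzP[a aE] := dvdz_lcml m m'; have /dvdzP[b bE] := dvdz_lcmr m m'.
rewrite -/L mulrC in aE; rewrite -/L mulrC in bE.
have a0 : a != 0 by apply: contraNneq L0 => a0; rewrite aE a0 mulr0.
have b0 : b != 0 by apply: contraNneq L0 => b0; rewrite bE b0 mulr0.
have step x : pj L x * pj m' n' = if (x == n' %[mod m'])%Z then pj L x else 0.
  by rewrite bE pj_mul_subr.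
rewrite (pj_expand n m0 a0) -aE mulr_suml big_mkcondr; apply: eq_bigr => c _.
exact: step.
Qed.

(* [pj U m n] behaves as the coset [n + mZ]: this is the intersection of two cosets
   with the common point [c]. *)
Lemma pj_mul_common m m' c : m != 0 -> m' != 0 ->
  pj m c * pj m' c = pj (lcmz m m') c.
Proof.
move=> m0 m0'; rewrite pj_mul //.
have L0 : lcmz m m' != 0 by rewrite lcmz_neq0 m0.
rewrite [RHS](@pj_expand _ 1) // mulr1; apply: eq_bigl => i.
by rewrite !eqz_mod_dvd dvdz_lcm !dvdzE.
Qed.

(** Whether the two cosets meet is decided classically. A common point can represent both of them;
    without one the sum in [pj_mul] is empty. *)
Lemma pj_mulP m m' n n' : m != 0 -> m' != 0 ->
  pj m n * pj m' n' = 0 \/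
  exists c, [/\ (c = n %[mod m])%Z, (c = n' %[mod m'])%Z
    & pj m n * pj m' n' = pj (lcmz m m') c].
Proof.
move=> m0 m0'.
have [[c [cn cn']]|no] :=
    pselect (exists c, (c = n %[mod m])%Z /\ (c = n' %[mod m'])%Z).
  right; exists c; split=> //.
  by rewrite -(pj_eqmod m0 cn) -(pj_eqmod m0' cn') pj_mul_common.
left; rewrite pj_mul // big1 // => c /andP[/eqP cn /eqP cn'].
by case: no; exists (c : nat)%:Z.
Qed.

Lemma uz_P_case p : uz_P U p -> p = 0 \/ exists m n, m != 0 /\ p = pj m n.
Proof. by []. Qed.

Lemma uz_P0 : uz_P U 0.
Proof. by left. Qed.

Lemma uz_P_pj m n : m != 0 -> uz_P U (pj m n).
Proof. by move=> m0; right; exists m, n. Qed.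

Lemma uz_P_mul p q : uz_P U p -> uz_P U q -> uz_P U (p * q).
Proof.
move=> /uz_P_case[->|[m [n [m0 ->]]]]; first by rewrite mul0r; left.
move=> /uz_P_case[->|[m' [n' [m0' ->]]]]; first by rewrite mulr0; left.
have [->|[c [_ _ ->]]] := pj_mulP n n' m0 m0'; first by left.
by apply: uz_P_pj; rewrite lcmz_neq0 m0.
Qed.

Lemma star_uz_P p : uz_P U p -> star p = p.
Proof. by move=> /uz_P_case[->|[m [n [m0 ->]]]]; [exact: star0|exact: star_pj]. Qed.

Lemma uz_PK p : uz_P U p -> p * p = p.
Proof. by move=> /uz_P_case[->|[m [n [m0 ->]]]]; [exact: mul0r|exact: pjK]. Qed.

Lemma uz_P_comm p q : uz_P U p -> uz_P U q -> p * q = q * p.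
Proof.
move=> hp hq; have := star_uz_P (uz_P_mul hp hq).
by rewrite starM !star_uz_P.
Qed.

Lemma uz_P_uconj k p : uz_P U p -> uz_P U (u k * p * u (- k)).
Proof.
move=> /uz_P_case[->|[m [n [m0 ->]]]]; first by rewrite mulr0 mul0r; left.
right; exists m, (k + n); split=> //.
by rewrite !mulrA (uz_uD rel) -!mulrA (uz_uD rel) opprD (addrC (- k)).
Qed.

Lemma s_pj_conj l m n : l != 0 -> m != 0 ->
  s l * pj m n * star (s l) = pj (l * m) (l * n).
Proof. by move=> l0 m0; rewrite -[s l]mul1r -(uz_u0 U) pj_conj // add0r. Qed.

Lemma uz_P_sconj l p : l != 0 -> uz_P U p -> uz_P U (s l * p * star (s l)).
Proof.
move=> l0 /uz_P_case[->|[m [n [m0 ->]]]]; first by rewrite mulr0 mul0r; left.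
by rewrite s_pj_conj //; apply: uz_P_pj; rewrite mulf_neq0.
Qed.

Lemma pj0 l : pj l 0 = s l * star (s l).
Proof. by rewrite /pj oppr0 uz_u0 mul1r mulr1. Qed.

(** Only the part of [p] below [e_l] survives. That part is 0 or the projection of a coset inside
    [l Z], hence of the form [s l * q * star (s l)] with [q] in P, and the isometries cancel. *)
Lemma uz_P_ssconj l p : l != 0 -> uz_P U p -> uz_P U (star (s l) * p * s l).
Proof.
move=> l0 /uz_P_case[->|[m [n [m0 ->]]]]; first by rewrite mulr0 mul0r; left.
have -> : star (s l) * pj m n * s l = star (s l) * (pj l 0 * pj m n) * s l.
  by rewrite pj0 !mulrA uz_ss // mul1r.
have [->|[c [cl _ ->]]] := pj_mulP 0 n l0 m0; first by rewrite mulr0 mul0r; left.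
have [c' ->] : exists c', c = l * c'.
  by case/eqz_modP: cl => c' ->; exists c'; rewrite add0r mulrC.
have L0 : lcmz l m != 0 by rewrite lcmz_neq0 l0.
have [a aE] : exists a, lcmz l m = l * a.
  by have /dvdzP[a ->] := dvdz_lcml l m; exists a; rewrite mulrC.
have a0 : a != 0 by apply: contraNneq L0 => a0; rewrite aE a0 mulr0.
have := uz_P_pj c' a0; rewrite aE -s_pj_conj //; move: (pj a c') => q hq.
by rewrite !mulrA uz_ss // mul1r -mulrA uz_ss // mulr1.
Qed.

End Pj.

(* The value at [a] of the extension of [xi U r] by zero. *)
Definition hold (R : realType) (U : UZ R) (r : Zhat) (a : U) : Prop :=
  exists m n, [/\ m != 0, a = pj U m n & zcong r m n].

Section Hold.
Variables (R : realType) (U : UZ R).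
Implicit Types (m n k l c : int) (p q : U) (r t : Zhat).
Local Notation u := (uz_u U).
Local Notation s := (uz_s U).
Local Notation pj := (pj U).
Let rel := uz_rel U.

(** The value must not depend on how the projection is written. If [pj m n = pj m' n'] with [r] in
    the second coset only, take [c] congruent to [r] modulo [m * m']: multiplying by the nonzero
    [pj (m * m') c] returns this projection on one side and 0 on the other. *)
Lemma hold_pj r m n : m != 0 -> hold r (pj m n) <-> zcong r m n.
Proof.
move=> m0; split=> [[m' [n' [m0' e h]]]|h]; last by exists m, n.
have mm : m * m' != 0 by rewrite mulf_neq0.
have [c hc] := zcong_ex r (m * m').
have hcm : zcong r m c by exact: zcong_dvd hc.
have hcm' : zcong r m' c by apply: (@zcong_dvd _ _ m); rewrite mulrC.
have cn' : (c = n' %[mod m'])%Z by exact/(zcong_eqmod _ hcm').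
apply/(zcong_eqmod _ hcm)/eqP/negPn/negP => cn.
have := @pj_mul_sub _ U m' m n' c m0' m0.
rewrite mulrC -e pj_mul_sub // (negPf cn) cn' eqxx => /eqP.
by rewrite eq_sym (negPf (pj_neq0 U c mm)).
Qed.

Lemma hold0 r : ~ hold r (0 : U).
Proof. by case=> m [n [m0 e _]]; have := pj_neq0 U n m0; rewrite -e eqxx. Qed.

Lemma hold_P r p : hold r p -> uz_P U p.
Proof. by case=> m [n [m0 -> _]]; exact: uz_P_pj. Qed.

Lemma hold_mul r p q : uz_P U p -> uz_P U q ->
  hold r (p * q) <-> hold r p /\ hold r q.
Proof.
move=> /uz_P_case[->|[m [n [m0 ->]]]]; first by rewrite mul0r; split=> [/hold0|[/hold0]].
move=> /uz_P_case[->|[m' [n' [m0' ->]]]].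
  by rewrite mulr0; split=> [/hold0|[_ /hold0]].
have L0 : lcmz m m' != 0 by rewrite lcmz_neq0 m0.
have [a aE] : exists a, lcmz m m' = m * a.
  by have /dvdzP[a ->] := dvdz_lcml m m'; exists a; rewrite mulrC.
have [b bE] : exists b, lcmz m m' = m' * b.
  by have /dvdzP[b ->] := dvdz_lcmr m m'; exists b; rewrite mulrC.
rewrite (hold_pj r n m0) (hold_pj r n' m0'); split=> [h|[h h']].
  case: (pj_mulP U n n' m0 m0') h => [->/hold0//|[c [cn cn' ->]]].
  move/(hold_pj _ _ L0) => hc.
  have hm : zcong r m c by apply: (@zcong_dvd _ _ a); rewrite -aE.
  have hm' : zcong r m' c by apply: (@zcong_dvd _ _ b); rewrite -bE.
  by split; [exact/(zcong_eqmod _ hm)|exact/(zcong_eqmod _ hm')].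
have [c hc] := zcong_ex r (lcmz m m').
have hm : zcong r m c by apply: (@zcong_dvd _ _ a); rewrite -aE.
have hm' : zcong r m' c by apply: (@zcong_dvd _ _ b); rewrite -bE.
have nc := (zcong_eqmod _ h).1 hm; have nc' := (zcong_eqmod _ h').1 hm'.
rewrite (pj_eqmod U m0 nc) (pj_eqmod U m0' nc') pj_mul_common //.
exact/hold_pj.
Qed.

Lemma hold_uconj r k p : uz_P U p ->
  hold r (u k * p * u (- k)) <-> hold (r - Zhat_one *~ k) p.
Proof.
move=> /uz_P_case[->|[m [n [m0 ->]]]]; first by rewrite mulr0 mul0r; split=> /hold0.
have -> : u k * pj m n * u (- k) = pj m (n + k).
  rewrite /pj !mulrA (uz_uD rel) -!mulrA (uz_uD rel) opprD.
  by rewrite (addrC k).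
rewrite !hold_pj // -{1}[r](subrK (Zhat_one *~ k)).
exact: zcongDz.
Qed.

Lemma hold_sconj r l p : l != 0 -> uz_P U p ->
  hold r (s l * p * star (s l)) <-> exists2 t, r = t *~ l & hold t p.
Proof.
move=> l0 /uz_P_case[->|[m [n [m0 ->]]]].
  by rewrite mulr0 mul0r; split=> [/hold0|[t _ /hold0]].
rewrite s_pj_conj // hold_pj ?mulf_neq0 //; split.
  by move/(zcong_divP _ _ l0 m0) => [t e h]; exists t => //; apply/hold_pj.
by move=> [t e /(hold_pj _ _ m0) h]; apply/(zcong_divP _ _ l0 m0); exists t.
Qed.

(** Conjugating back by [s l] gives [e_l * p], and [e_l] takes the value 1 at [r *~ l]. So the rule
    for [s l] applies at that point, and injectivity of multiplication by [l] recovers [r]. *)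
Lemma hold_ssconj r l p : l != 0 -> uz_P U p ->
  hold r (star (s l) * p * s l) <-> hold (r *~ l) p.
Proof.
move=> l0 hp.
have hq := uz_P_ssconj l0 hp; set q := star (s l) * p * s l in hq *.
have he : uz_P U (pj l 0) by exact: uz_P_pj.
have qE : s l * q * star (s l) = pj l 0 * p.
  transitivity (pj l 0 * p * pj l 0); first by rewrite pj0 /q !mulrA.
  by rewrite -mulrA -(uz_P_comm he hp) mulrA pjK.
have h0 : hold (r *~ l) (pj l 0).
  by apply/hold_pj => //; apply/(zcongP _ _ l0); exists r; rewrite mulr0z add0r.
transitivity (hold (r *~ l) (s l * q * star (s l))).
  rewrite hold_sconj //; split=> [h|[t /(Zhat_mulrzI l0) -> //]].
  by exists r.
by rewrite qE hold_mul //; split=> [[]|].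
Qed.

End Hold.

(** * The elements [s_m^* u^k s_n] and the action of [P_Q] *)

Lemma embR_inj : injective embR.
Proof.
move=> r t /Rin_eq[l [l' [h1 h2]]].
have ll' : l = l' by apply: (@mulNposI Npos1); rewrite mulNposC h1 mulNposC.
by apply: (@Zhat_mulrnI (val l) (valP l)); rewrite /= h2 ll'.
Qed.

Lemma Rin_embR (p : Npos) (x t : Zhat) : Rin p x = embR t <-> x = t *+ val p.
Proof.
split=> [/Rin_eq[l [l' [h1 h2]]]|->].
  have /(congr1 val) /= h := h1.
  apply: (@Zhat_mulrnI (val l) (valP l)).
  by rewrite /= h2 -mulrnA; congr (_ *+ _); rewrite mulnC h muln1.
by apply/Rin_eq; exists Npos1, p; split; first exact: mulNposC.
Qed.

(* [r.g = t], with [r] and [t] both in [Zhat]. *)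
Definition grel (g : PQ) (r t : Zhat) : Prop := Ract (embR r) g = embR t.

Lemma grel_fun g r t t' : grel g r t -> grel g r t' -> t = t'.
Proof. by rewrite /grel => -> /embR_inj. Qed.

Lemma PQ_frac (g : PQ) : exists m k n : int,
  [/\ m != 0, n != 0 & PQmx g = aff (k%:Q / m%:Q) (n%:Q / m%:Q)].
Proof.
have db : (denq (g 1 0))%:Q != 0 by rewrite intr_eq0 denq_neq0.
have da : (denq (g 1 1))%:Q != 0 by rewrite intr_eq0 denq_neq0.
exists (denq (g 1 0) * denq (g 1 1)), (numq (g 1 0) * denq (g 1 1)),
  (numq (g 1 1) * denq (g 1 0)); split.
- by rewrite mulf_neq0 ?denq_neq0.
- by rewrite mulf_neq0 ?denq_neq0 // numq_eq0 PQ11.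
rewrite {1}PQ_aff !intrM; congr aff.
  by rewrite -mulf_div divff // mulr1 divq_num_den.
by rewrite (mulrC (denq (g 1 0))%:~R) -mulf_div divff // mulr1 divq_num_den.
Qed.

Lemma frac_PQ (m k n : int) : m != 0 -> n != 0 ->
  exists g : PQ, PQmx g = aff (k%:Q / m%:Q) (n%:Q / m%:Q).
Proof.
move=> m0 n0; have a0 : n%:Q / m%:Q != 0 by rewrite mulf_neq0 ?invr_eq0 ?intr_eq0.
by exists (MkPQ (inPQ_aff (k%:Q / m%:Q) a0)).
Qed.

Lemma PQ_frac_inv (g : PQ) (m k n : int) : m != 0 -> n != 0 ->
  PQmx g = aff (k%:Q / m%:Q) (n%:Q / m%:Q) ->
  PQmx (g^-1)%g = aff ((- k)%:Q / n%:Q) (m%:Q / n%:Q).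
Proof.
move=> m0 n0 gE; rewrite [LHS]/=.
have mQ : m%:Q != 0 by rewrite intr_eq0.
have nQ : n%:Q != 0 by rewrite intr_eq0.
rewrite gE !mxE /= rmorphN /=; congr aff; last by rewrite invf_div.
by field; rewrite mQ nQ.
Qed.

Lemma PQ_frac_mul (g h : PQ) (m k n m' k' n' : int) : m != 0 -> m' != 0 ->
  PQmx g = aff (k%:Q / m%:Q) (n%:Q / m%:Q) ->
  PQmx h = aff (k'%:Q / m'%:Q) (n'%:Q / m'%:Q) ->
  PQmx (g * h)%g =
    aff ((k * m' + n * k')%:Q / (m * m')%:Q) ((n * n')%:Q / (m * m')%:Q).
Proof.
move=> m0 m0' gE hE; rewrite [LHS]/= gE hE aff_mul.
have mQ : m%:Q != 0 by rewrite intr_eq0.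
have mQ' : m'%:Q != 0 by rewrite intr_eq0.
by rewrite !rmorphD !rmorphM /=; congr aff; field; rewrite mQ mQ'.
Qed.

Lemma grelE (g : PQ) (m k n : int) (r t : Zhat) : m != 0 -> n != 0 ->
  PQmx g = aff (k%:Q / m%:Q) (n%:Q / m%:Q) ->
  grel g r t <-> r *~ m - Zhat_one *~ k = t *~ n.
Proof.
move=> m0 n0 gE.
(* [lactE] asks for a positive denominator, so the fractions of [g^-1] over [n] are expanded by the
   sign of [n], which is cancelled at the end. *)
have nn : (val (absNpos n))%:Z = n * sgz n by rewrite absNposE //; lia.
have s0 : sgz n != 0 by rewrite sgz_eq0.
have sQ : (sgz n)%:Q != 0 by rewrite intr_eq0.
have nQ : n%:Q != 0 by rewrite intr_eq0.
have : PQmx (g^-1)%g = aff ((- k * sgz n)%:Q / (val (absNpos n))%:Q)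
    ((m * sgz n)%:Q / (val (absNpos n))%:Q).
  rewrite (PQ_frac_inv m0 n0 gE) nn !intrM -!mulf_div divff // !mulr1.
  by [].
move/lactE => /(_ Npos1 r); rewrite /grel /Ract /embR => ->.
rewrite -/(embR t) Rin_embR mulr1.
have -> : r *~ (m * sgz n) + Zhat_one *~ (- k * sgz n)
    = (r *~ m - Zhat_one *~ k) *~ sgz n.
  by rewrite mulrzBl -!mulrzA mulNr mulrNz.
have -> : t *+ val (mulNpos (absNpos n) Npos1) = t *~ n *~ sgz n.
  by rewrite /= muln1 pmulrn nn mulrzA.
by split=> [/(Zhat_mulrzI s0)|->].
Qed.

Definition uz_S (R : realType) (U : UZ R) (m k n : int) : U :=
  star (uz_s U m) * uz_u U k * uz_s U n.

(* The element [s_m^* u^k s_n] of [g], read off the fraction with common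
   denominator [m = denq (g 1 0) * denq (g 1 1)]; [SgE] gives it for all fractions. *)
Definition Sg (R : realType) (U : UZ R) (g : PQ) : U :=
  uz_S U (denq (g 1 0) * denq (g 1 1)) (numq (g 1 0) * denq (g 1 1))
    (numq (g 1 1) * denq (g 1 0)).

Section SgTheory.
Variables (R : realType) (U : UZ R).
Implicit Types (m n k l c : int) (p q : U) (r t : Zhat) (g h : PQ).
Local Notation u := (uz_u U).
Local Notation s := (uz_s U).
Local Notation pj := (pj U).
Local Notation Sg := (Sg U).
Local Notation uz_S := (uz_S U).
Let rel := uz_rel U.

(** In [star (s m) * star (s l) * u (l * k) * s l * s n] the factor [s l] passes [u (l * k)],
    leaving [u k], and meets [star (s l)]. This is why only the fractions [k / m] and [n / m]
    matter. *)
Lemma uz_S_scale l m k n : l != 0 -> m != 0 -> n != 0 ->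
  uz_S (l * m) (l * k) (l * n) = uz_S m k n.
Proof.
move=> l0 m0 n0; rewrite /uz_S (mulrC l m) -star_uz_sM // -(uz_sM rel) //.
rewrite -!mulrA (mulrA (u (l * k))) -(uz_su rel) // !mulrA.
by rewrite -(mulrA _ (star (s l))) uz_ss // mulr1.
Qed.

Lemma uz_S_eq m k n m' k' n' : m != 0 -> n != 0 -> m' != 0 -> n' != 0 ->
  k%:Q / m%:Q = k'%:Q / m'%:Q -> n%:Q / m%:Q = n'%:Q / m'%:Q ->
  uz_S m k n = uz_S m' k' n'.
Proof.
move=> m0 n0 m0' n0' /eqP; rewrite eqr_div ?intr_eq0 // -!intrM => /eqP/intr_inj kk.
move=> /eqP; rewrite eqr_div ?intr_eq0 // -!intrM => /eqP/intr_inj nn.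
rewrite -(uz_S_scale k m0' m0 n0) -(uz_S_scale k' m0 m0' n0').
by rewrite (mulrC m' k) kk (mulrC m' n) nn !(mulrC m).
Qed.

Lemma SgE g m k n : m != 0 -> n != 0 ->
  PQmx g = aff (k%:Q / m%:Q) (n%:Q / m%:Q) -> Sg g = uz_S m k n.
Proof.
move=> m0 n0 gE.
have db : (denq (g 1 0))%:Q != 0 by rewrite intr_eq0 denq_neq0.
have da : (denq (g 1 1))%:Q != 0 by rewrite intr_eq0 denq_neq0.
apply: uz_S_eq => //.
- by rewrite mulf_neq0 ?denq_neq0.
- by rewrite mulf_neq0 ?denq_neq0 // numq_eq0 PQ11.
- by rewrite !intrM -mulf_div divff // mulr1 divq_num_den gE !mxE.
rewrite !intrM (mulrC (denq (g 1 0))%:~R) -mulf_div divff // mulr1 divq_num_den.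
by rewrite gE !mxE.
Qed.

Lemma star_Sg g : star (Sg g) = Sg (g^-1)%g.
Proof.
have [m [k [n [m0 n0 gE]]]] := PQ_frac g.
rewrite (SgE m0 n0 gE) (SgE n0 m0 (PQ_frac_inv m0 n0 gE)).
by rewrite /uz_S !starM starK star_uz_u mulrA.
Qed.

Lemma uz_P_Sg g p : uz_P U p -> uz_P U (Sg g * p * star (Sg g)).
Proof.
move=> hp; have [m [k [n [m0 n0 gE]]]] := PQ_frac g; rewrite (SgE m0 n0 gE).
have := uz_P_ssconj m0 (uz_P_uconj k (uz_P_sconj n0 hp)).
by rewrite /uz_S !starM starK star_uz_u !mulrA.
Qed.

(** The conjugation rules for [star (s m)], [u k] and [s n], applied in turn, leave the equation
    [r m - k = t n], which [grelE] identifies with [r.g = t]. So acting by [Sg g] on the characters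
    [xi r] is acting by [g] on [Zhat]. *)
Lemma hold_Sg r g p : uz_P U p ->
  hold r (Sg g * p * star (Sg g)) <-> exists2 t, grel g r t & hold t p.
Proof.
move=> hp; have [m [k [n [m0 n0 gE]]]] := PQ_frac g; rewrite (SgE m0 n0 gE).
transitivity (hold r (star (s m) * (u k * (s n * p * star (s n)) * u (- k)) * s m)).
  by rewrite /uz_S !starM starK star_uz_u !mulrA.
rewrite hold_ssconj //; last exact/uz_P_uconj/uz_P_sconj.
rewrite hold_uconj; last exact: uz_P_sconj.
rewrite hold_sconj //; split=> -[t e h]; exists t => //; exact/(grelE _ _ m0 n0 gE).
Qed.

Lemma pj10 : pj 1 0 = 1.
Proof. by rewrite -(@pj_sum1 _ U 1) // big_ord1. Qed.

Lemma uz_P1 : uz_P U 1.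
Proof. by rewrite -pj10; exact: uz_P_pj. Qed.

Lemma hold1 r : hold r (1 : U).
Proof.
rewrite -pj10; apply/hold_pj => //; apply/zcongP => //.
by exists r; rewrite mulr0z add0r.
Qed.

Lemma uz_P_SgSg g : uz_P U (Sg g * star (Sg g)).
Proof. by rewrite -[X in X * _]mulr1; apply: uz_P_Sg; exact: uz_P1. Qed.

Lemma hold_SgSg r g : hold r (Sg g * star (Sg g)) <-> exists t, grel g r t.
Proof.
rewrite -[X in X * _]mulr1 hold_Sg; last exact: uz_P1.
by split=> [[t ? _]|[t ?]]; exists t => //; exact: hold1.
Qed.

Lemma SgK g : Sg g * star (Sg g) * Sg g = Sg g.
Proof.
have [m [k [n [m0 n0 gE]]]] := PQ_frac g; rewrite (SgE m0 n0 gE).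
have hn : uz_P U (u k * (s n * 1 * star (s n)) * u (- k)).
  by apply: uz_P_uconj; apply: uz_P_sconj => //; exact: uz_P1.
have hm : uz_P U (s m * 1 * star (s m)) by apply: uz_P_sconj => //; exact: uz_P1.
have := uz_P_comm hn hm; rewrite !mulr1 => comm.
rewrite /uz_S !starM starK star_uz_u.
transitivity (star (s m) * (u k * (s n * star (s n)) * u (- k) * (s m * star (s m)))
    * u k * s n); first by rewrite !mulrA.
rewrite comm !mulrA uz_ss // mul1r.
rewrite -(mulrA _ (u (- k))) uz_uNM mulr1.
by rewrite -(mulrA _ (star (s n))) uz_ss // mulr1.
Qed.

Lemma Sg_comm g p : uz_P U p ->
  Sg g * p = Sg g * p * star (Sg g) * Sg g.
Proof.
move=> hp; have := uz_P_SgSg (g^-1)%g; rewrite -star_Sg starK => h.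
have := SgK g; move: (Sg g) h => S h SK.
by rewrite -(mulrA _ (star _)) -(mulrA _ p) (uz_P_comm hp h) !mulrA SK.
Qed.

(** The defect from multiplicativity is a range projection. On the right, [e_m] commutes with
    [u k * e_n * u (- k)] and is absorbed by [star (s m)]; what remains after
    [star (s m) * u k * s n] collapses to [star (s m') * u k' * s n']. *)
Lemma Sg_mul g h : Sg g * Sg h = Sg g * star (Sg g) * Sg (g * h)%g.
Proof.
have [m [k [n [m0 n0 gE]]]] := PQ_frac g.
have [m' [k' [n' [m0' n0' hE]]]] := PQ_frac h.
have mm : m * m' != 0 by rewrite mulf_neq0.
have nn : n * n' != 0 by rewrite mulf_neq0.
have hn : uz_P U (u k * (s n * 1 * star (s n)) * u (- k)).
  by apply: uz_P_uconj; apply: uz_P_sconj => //; exact: uz_P1.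
have hm : uz_P U (s m * 1 * star (s m)) by apply: uz_P_sconj => //; exact: uz_P1.
have := uz_P_comm hn hm; rewrite !mulr1 => comm.
rewrite (SgE m0 n0 gE) (SgE m0' n0' hE) (SgE mm nn (PQ_frac_mul m0 m0' gE hE)).
rewrite /uz_S !starM starK star_uz_u -(star_uz_sM _ m0 m0') -(uz_sM rel n0 n0').
transitivity (star (s m) * (u k * (s n * star (s n)) * u (- k) * (s m * star (s m)))
    * star (s m') * u (k * m' + n * k') * (s n * s n')); last by rewrite !mulrA.
rewrite comm !mulrA uz_ss // mul1r.
have e1 : u (- k) * star (s m') * u (k * m' + n * k') = star (s m') * u (n * k').
  rewrite uz_us // -mulrA (uz_uD rel); congr (_ * u _); ring.
have e2 : star (s n) * star (s m') * s n = star (s m').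
  by rewrite star_uz_sM // mulrC -star_uz_sM // -mulrA uz_ss // mulr1.
rewrite -(mulrA _ (u (- k))) -(mulrA _ (u (- k) * _)) e1 !mulrA.
rewrite -(mulrA _ (u (n * k'))) -(uz_su rel) // !mulrA.
by rewrite -(mulrA _ (star (s n))) -(mulrA _ (star (s n) * _)) e2.
Qed.

Lemma uz_T_PSg p g : uz_P U p -> uz_T U (p * Sg g).
Proof.
have [m [k [n [m0 n0 gE]]]] := PQ_frac g; rewrite (SgE m0 n0 gE).
move=> /uz_P_case[->|[m' [n' [m0' ->]]]]; first by rewrite mul0r; left.
(* A projection moves to the right of [star (s m)] by being conjugated with [s m], which turns
   [pj m' n'] into [pj (m * m') (m * n')]. *)
right; exists m, n, (m * m'), (m * n'), (- (m * n') + k); split=> //.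
  by rewrite mulf_neq0.
transitivity (star (s m) * pj (m * m') (m * n') * u k * s n).
  by rewrite -s_pj_conj //; move: (pj m' n') => q; rewrite /uz_S !mulrA uz_ss // mul1r.
by rewrite /pj -(uz_uD rel) !mulrA.
Qed.

Lemma uz_T_Sg g : uz_T U (Sg g).
Proof. by rewrite -SgK; apply: uz_T_PSg; exact: uz_P_SgSg. Qed.

(** In [star (s m) * pj k n * u (n + n') * s m'] one may insert [e_m] after [star (s m)] and commute
    it past [pj k n]. This splits off the projection [star (s m) * pj k n * s m]. *)
Lemma uz_T_case a : uz_T U a -> exists p g, uz_P U p /\ a = p * Sg g.
Proof.
case=> [->|[m [m' [k [n [n' [m0 m0' k0 ->]]]]]]].
  by exists 0, 1%g; split; [exact: uz_P0|rewrite mul0r].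
have [g gE] := @frac_PQ m (n + n') m' m0 m0'.
exists (star (s m) * pj k n * s m), g; split.
  by apply: uz_P_ssconj => //; exact: uz_P_pj.
rewrite (SgE m0 m0' gE) /uz_S.
have hm : uz_P U (s m * 1 * star (s m)) by apply: uz_P_sconj => //; exact: uz_P1.
have := uz_P_comm (uz_P_pj U n k0) hm; rewrite mulr1 => comm.
transitivity (star (s m) * (pj k n * (s m * star (s m))) * u (n + n') * s m').
  rewrite comm !mulrA uz_ss // mul1r -(uz_uD rel) /pj !mulrA.
  by rewrite -(mulrA _ (u (- n))) uz_uNM mulr1.
by rewrite !mulrA.
Qed.

(* The affine maps of [g] and [h] agree on every integer of the coset of [Z] that
   [p * (Sg g * star (Sg g))] represents, hence are equal. *)
Lemma Sg_inj r p g h : uz_P U p -> p * Sg g = p * Sg h ->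
  hold r p -> hold r (Sg g * star (Sg g)) -> g = h.
Proof.
move=> hp e rp rg.
have point z : hold z p -> hold z (Sg g * star (Sg g)) ->
    exists2 t, grel g z t & grel h z t.
  move=> zp /hold_SgSg[t gt]; exists t => //.
  (* Multiplying [Sg g * q * star (Sg g)] by [p] on both sides keeps its value at [z] and gives the
     same element as with [h]. Since projections separate the points of [Zhat], [g] and [h] send [z]
     to the same point. *)
  have key q : uz_P U q -> hold t q -> exists2 t', grel h z t' & hold t' q.
    move=> hq tq; apply/(hold_Sg _ _ hq).
    have hh := uz_P_Sg h hq; have hg := uz_P_Sg g hq.
    have : hold z (p * (Sg g * q * star (Sg g)) * p).
      apply/hold_mul => //; first exact: uz_P_mul.
      split=> //; apply/hold_mul => //; split=> //.
      by apply/hold_Sg => //; exists t.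
    have -> : p * (Sg g * q * star (Sg g)) * p = p * (Sg h * q * star (Sg h)) * p.
      have conjE S : p * (S * q * star S) * p = p * S * q * star (p * S).
        by rewrite starM (star_uz_P hp) !mulrA.
      by rewrite conjE e -conjE.
    by move=> /(hold_mul _ (uz_P_mul hp hh) hp)[/(hold_mul _ hp hh)[]].
  have [t' ht' _] := key 1 uz_P1 (hold1 t).
  rewrite (_ : t = t') //; apply: Zhat_eq_zcong => m n m0.
  move=> /(hold_pj U _ _ m0)/(key _ (uz_P_pj U n m0))[t'' ht'' h2].
  by rewrite (grel_fun ht' ht''); exact/(hold_pj U).
have [M [c [M0 fE rMc]]] : hold r (p * (Sg g * star (Sg g))).
  by apply/hold_mul => //; exact: uz_P_SgSg.
have coset z : (z = c %[mod M])%Z ->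
    exists2 t, grel g (Zhat_one *~ z) t & grel h (Zhat_one *~ z) t.
  move=> zc; have : hold (Zhat_one *~ z) (p * (Sg g * star (Sg g))).
    by rewrite fE; apply/hold_pj => //; exact/zcong_int.
  by rewrite hold_mul //; [case; exact: point|exact: uz_P_SgSg].
have [m [k [n [m0 n0 gE]]]] := PQ_frac g.
have [m' [k' [n' [m0' n0' hE]]]] := PQ_frac h.
have one_inj (a b : int) : Zhat_one *~ a = Zhat_one *~ b -> a = b.
  move=> ab; apply/eqP; rewrite -subr_eq0; apply/negPn/negP => ab0.
  have : Zhat_one *~ (a - b) = 0 *~ (a - b) by rewrite mul0rz mulrzBr ab subrr.
  move=> /(Zhat_mulrzI ab0).
  by move=> /(congr1 (fun x => zcomp x (exist _ 2%N isT) : nat)).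
have eqn z : (z = c %[mod M])%Z -> n' * (z * m - k) = n * (z * m' - k').
  move=> /coset[t /(grelE _ _ m0 n0 gE) e1 /(grelE _ _ m0' n0' hE) e2].
  rewrite -mulrzA -mulrzBr in e1; rewrite -mulrzA -mulrzBr in e2.
  apply: one_inj; rewrite ![_ * (_ - _)]mulrC [LHS]mulrzA e1 [RHS]mulrzA e2.
  by rewrite -!mulrzA (mulrC n).
(* The equation is affine in [z]: its instances at [c] and [c + M] give equality of the slopes, then
   of the translation parts. *)
have h1 := eqn c erefl.
have h2 : n' * ((c + M) * m - k) = n * ((c + M) * m' - k').
  by apply: eqn; rewrite modzDr.
have h3 : n' * m = n * m'.
  by apply: (mulIf M0); move: h1 h2; lia.
have h4 : n' * k = n * k' by have := congr1 ( *%R c) h3; move: h1; lia.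
have h5 : k * m' = k' * m.
  apply: (mulfI n0'); apply: (mulfI n0).
  transitivity (n' * k * (n * m')); first by ring.
  by rewrite -h3 h4; ring.
apply: val_inj; rewrite /= gE hE; congr aff; apply/eqP.
  by rewrite eqr_div ?intr_eq0 // -!intrM h5.
by rewrite eqr_div ?intr_eq0 // -!intrM h3.
Qed.

End SgTheory.

(** * Characters of P *)

Definition mkP (R : realType) (U : UZ R) (p : U) (hp : uz_P U p) :
  set_type (uz_P U) := SigSub (mem_set hp).

Section Characters.
Variables (R : realType) (U : UZ R).
Implicit Types (m n k l c : int) (p q : U) (r t : Zhat) (g h : PQ) (x : Defs.Pfun U).
Local Notation pj := (pj U).
Local Notation Sg := (Sg U).
Local Notation xi := (xi U).

Lemma set_type_P (e : set_type (uz_P U)) : uz_P U (val e).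
Proof. exact: (set_mem (valP e)). Qed.

Lemma ev_val x (e : set_type (uz_P U)) : ev x (val e) = x e.
Proof.
by apply/asboolP/idP => [[f /val_inj -> //]|xe]; exists e.
Qed.

Lemma ev_P x p : ev x p -> uz_P U p.
Proof. by move=> /asboolP[e <- _]; exact: set_type_P. Qed.

Lemma ev_mkP x p (hp : uz_P U p) : ev x p = x (mkP hp).
Proof. by rewrite -ev_val. Qed.

Lemma xi_val r (e : set_type (uz_P U)) : xi r e <-> hold r (val e).
Proof. by split=> [/asboolP|h]; last exact/asboolP. Qed.

Lemma ev_xi r p : ev (xi r) p <-> hold r p.
Proof.
split=> [/asboolP[e <- /xi_val//]|h].
by rewrite (ev_mkP _ (hold_P h)); apply/xi_val.
Qed.

Lemma xi_char r : is_char U (xi r).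
Proof.
split.
- by exists (mkP (uz_P1 U)); apply/xi_val; exact: hold1.
- move=> e f; apply/idP/andP => [/ev_xi|[/xi_val he /xi_val hf]].
    by move=> /(hold_mul _ (set_type_P e) (set_type_P f))[? ?]; split; apply/xi_val.
  by apply/ev_xi/hold_mul => //; exact: set_type_P.
by apply/negP => /ev_xi/hold0.
Qed.

Definition xiH r : hatP0 U := SigSub (mem_set (xi_char r)).

Lemma xi_inj : injective xi.
Proof.
move=> r t h; apply: Zhat_eq_zcong => m n m0 /(hold_pj U _ _ m0)/ev_xi.
by rewrite h => /ev_xi/(hold_pj U _ _ m0).
Qed.

Lemma hatP0_char (x : hatP0 U) : is_char U (val x).
Proof. exact: (set_mem (valP x)). Qed.

Lemma char_evM x p q : is_char U x -> uz_P U p -> uz_P U q ->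
  ev x (p * q) = ev x p && ev x q.
Proof.
by case=> _ h _ hp hq; have := h (mkP hp) (mkP hq); rewrite -!ev_mkP.
Qed.

Lemma char_ev0 x : is_char U x -> ev x 0 = false.
Proof. by case. Qed.

Lemma char_ev1 x : is_char U x -> ev x 1.
Proof.
move=> cx; case: (cx) => -[e xe] _ _.
have := char_evM cx (uz_P1 U) (set_type_P e).
by rewrite mul1r ev_val xe andbT.
Qed.

Lemma char_ev_dvd x m k c : is_char U x -> m != 0 -> k != 0 ->
  ev x (pj (m * k) c) -> ev x (pj m c).
Proof.
move=> cx m0 k0; have mk : m * k != 0 by rewrite mulf_neq0.
have := pj_mul_sub U c c m0 k0; rewrite eqxx => <-.
by rewrite char_evM //; [case/andP|exact: uz_P_pj|exact: uz_P_pj].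
Qed.

Lemma char_ev_eqmod x m n n' : is_char U x -> m != 0 ->
  ev x (pj m n) -> ev x (pj m n') -> (n = n' %[mod m])%Z.
Proof.
move=> cx m0 h h'; apply/eqP/negPn/negP => nn'.
have := char_evM cx (uz_P_pj U n m0) (uz_P_pj U n' m0).
by rewrite pj_orth // char_ev0 // h h'.
Qed.

(** A character takes the value 1 on at most one coset of each [m], and passes from a coset to any
    larger one. The chosen residues [N m] are therefore compatible, define a point of [Zhat], and
    determine the character. *)
Lemma char_eq_xi x : is_char U x ->
  (forall m, m != 0 -> exists n, ev x (pj m n)) -> exists r, x = xi r.
Proof.
move=> cx ex.
have [N NP] : exists N : int -> int, forall m, m != 0 -> ev x (pj m (N m)).
  suff /choice[N NP] : forall m, exists n, m != 0 -> ev x (pj m n) by exists N.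
  move=> m.
  have [->|m0] := eqVneq m 0; first by exists 0.
  by have [n h] := ex m m0; exists n.
have Ndvd m k : m != 0 -> k != 0 -> (N (m * k) = N m %[mod m])%Z.
  move=> m0 k0; apply: (char_ev_eqmod cx m0); last exact: NP.
  by apply: (@char_ev_dvd _ _ k) => //; apply: NP; rewrite mulf_neq0.
pose f (k : Npos) := `|(N (val k)%:Z %% (val k)%:Z)%Z|%N.
have pos (k : Npos) : (val k)%:Z != 0 by have := valP k; lia.
have fE (k : Npos) : ((f k)%:Z = N (val k)%:Z %[mod val k])%Z.
  by rewrite /f gez0_abs ?modz_mod // modz_ge0.
have fP (m k : Npos) : f (mulNpos m k) = f m %[mod val m].
  suff : ((f (mulNpos m k))%:Z = (f m)%:Z %[mod val m])%Z.
    by rewrite !modz_nat => -[].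
  rewrite fE -(Ndvd _ _ (pos m) (pos k)).
  have /eqz_modP[j ->] := fE (mulNpos m k).
  apply/eqz_modP; exists (j * (val k)%:Z).
  by rewrite /= PoszM; ring.
exists (Zhat_mk fP).
have cong m n : m != 0 -> zcong (Zhat_mk fP) m n <-> (N m = n %[mod m])%Z.
  move=> m0; apply: zcong_eqmod; rewrite /zcong zcomp_mk.
  have s0 : sgz m != 0 by rewrite sgz_eq0.
  apply/eqmodz_abs; rewrite -absNposE // -modz_nat modz_mod fE.
  rewrite absNposE //; apply/eqmodz_abs.
  (* [N m] and the residue chosen for [|m|] are independent choices; they agree modulo [m] because
     [|m| = m * sgz m]. *)
  rewrite -(Ndvd m (sgz m)) //; congr ((N _ %% _)%Z); lia.
apply/funext => e; apply/idP/idP => [|/xi_val]; rewrite -ev_val.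
  case: (uz_P_case (set_type_P e)) => [e0|[m [n [m0 eE]]]] xe.
    by rewrite e0 char_ev0 in xe.
  rewrite eE in xe; apply/xi_val; rewrite eE; apply/hold_pj => //; apply/cong => //.
  by apply: (char_ev_eqmod cx m0) => //; exact: NP.
case=> m [n [m0 -> /(cong _ _ m0) h]].
by rewrite -(pj_eqmod U m0 h); exact: NP.
Qed.

(** The support of [xi r] already contains a coset of every [m], and a character above it cannot
    take a second one. *)
Lemma xi_maximal r : maximal_char U (xiH r).
Proof.
move=> y sub; apply/seteqP; split=> //= e ye; apply/xi_val.
have cy := hatP0_char y; rewrite /supp /= -ev_val in ye.
case: (uz_P_case (set_type_P e)) ye => [->|[m [n [m0 ->]]]] ye.
  by rewrite char_ev0 in ye.
have [c rc] := zcong_ex r m.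
have yc : ev (val y) (pj m c).
  rewrite (ev_mkP _ (uz_P_pj U c m0)); apply: sub; apply/xi_val.
  exact/hold_pj.
apply/hold_pj => //; apply/(zcong_eqmod _ rc).
exact: (char_ev_eqmod cy m0 yc ye).
Qed.

(* Some coset of [m] is compatible with [x], for otherwise the finitely many
   [p] in the support of [x] killing one coset each have product [0]. *)
Lemma char_meet_pj x m : is_char U x -> m != 0 ->
  exists n, forall p, ev x p -> p * pj m n != 0.
Proof.
move=> cx m0; apply: contrapT => no.
have F n : exists2 p, ev x p & p * pj m n = 0.
  apply: contrapT => h; apply: no; exists n => p xp; apply/eqP => e.
  by apply: h; exists p.
have [p xp pE] : exists2 p, ev x p & forall c : 'I_`|m|%N, p * pj m (c : nat)%:Z = 0.
  have [p xp pE] : exists2 p, ev x p &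
      forall c : 'I_`|m|%N, c \in enum 'I_`|m|%N -> p * pj m (c : nat)%:Z = 0.
    elim: (enum _) => [|c s [p xp ps]]; first by exists 1; first exact: char_ev1.
    have [q xq qc] := F (c : nat)%:Z; exists (p * q).
      by rewrite char_evM ?xp ?xq //; apply: ev_P; eassumption.
    move=> d; rewrite inE => /orP[/eqP ->|/ps pd]; first by rewrite -mulrA qc mulr0.
    rewrite (uz_P_comm (ev_P xp) (ev_P xq)) -mulrA pd mulr0.
    by [].
  by exists p => // c; apply: pE; rewrite mem_enum.
have : p = 0.
  by rewrite -[p]mulr1 -(pj_sum1 U m0) mulr_sumr big1 // => c _; exact: pE.
by move=> p0; move: xp; rewrite p0 char_ev0.
Qed.

Lemma maximal_ev (x : hatP0 U) m : maximal_char U x -> m != 0 ->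
  exists n, ev (val x) (pj m n).
Proof.
move=> mx m0; have cx := hatP0_char x.
have [n nP] := char_meet_pj cx m0; exists n.
set q := pj m n in nP *; have hq : uz_P U q by exact: uz_P_pj.
have qq := uz_PK hq; clearbody q.
(* The support of [y] is the filter generated by [q] and the support of [x], the equation saying
   that [p * q] lies below [e]. It avoids 0 by the choice of [n], so maximality of [x] puts [q] in
   the support of [x]. *)
pose y : Defs.Pfun U := fun e => `[< exists2 p, ev (val x) p & p * q * val e = p * q >].
have evy p : uz_P U p -> ev y p <-> exists2 f, ev (val x) f & f * q * p = f * q.
  by move=> hp; rewrite (ev_mkP _ hp); split=> [/asboolP|h]; last exact/asboolP.
have cy : is_char U y.
  split.
  - exists (mkP (uz_P1 U)); rewrite -ev_mkP; apply/evy; first exact: uz_P1.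
    by exists 1; [exact: char_ev1|rewrite mulr1].
  - move=> e f; have he := set_type_P e; have hf := set_type_P f.
    rewrite -!ev_val; move: (val e) (val f) he hf => {}e {}f he hf.
    apply/idP/andP.
      move=> /(evy _ (uz_P_mul he hf))[p xp pE]; split; apply/evy => //; exists p => //.
        by rewrite -pE -!mulrA -(uz_P_comm he hf) (mulrA e) uz_PK.
      by rewrite -pE -!mulrA uz_PK.
    case=> /(evy _ he)[p xp pE] /(evy _ hf)[p' xp' pE'].
    apply/evy; first exact: uz_P_mul.
    have hp := ev_P xp; have hp' := ev_P xp'.
    exists (p' * p); first by rewrite char_evM ?xp ?xp'.
    rewrite -!mulrA (mulrA p) (mulrA (p * q)) pE !mulrA.
    by rewrite (uz_P_comm hp' hp) -!mulrA (mulrA p' q) pE'.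
  apply/negP => /(evy _ (uz_P0 U))[p xp]; rewrite mulr0 => /esym/eqP.
  by apply/negP; exact: nP.
pose yH : hatP0 U := SigSub (mem_set cy).
have sub : supp x `<=` supp yH.
  move=> e; rewrite /supp /= => xe; apply/asboolP; exists (val e); first by rewrite ev_val.
  have he := set_type_P e.
  by rewrite -mulrA (uz_P_comm hq he) mulrA uz_PK.
have : supp yH (mkP hq).
  rewrite /supp /= -ev_mkP; apply/evy => //; exists 1; first exact: char_ev1.
  by rewrite mul1r qq.
by rewrite (mx _ sub) /supp /= -ev_mkP.
Qed.

Lemma eval_continuous (e : set_type (uz_P U)) :
  continuous (fun x : hatP0 U => val x e).
Proof.
move=> x; apply: (@continuous_comp (hatP0 U) (Defs.Pfun U) bool val (fun y => y e)).
  exact: initial_continuous.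
exact: proj_continuous.
Qed.

Lemma open_eval p : open [set x : hatP0 U | ev (val x) p].
Proof.
have [hp|hp] := pselect (uz_P U p); last first.
  rewrite (_ : [set _ | _] = set0); first exact: open0.
  by apply/seteqP; split=> // x /= /ev_P.
rewrite (_ : [set _ | _] = (fun x : hatP0 U => val x (mkP hp)) @^-1` [set true]).
  apply: (@open_comp _ _ (fun x : hatP0 U => val x (mkP hp)) [set true]).
    by move=> x _; exact: eval_continuous.
  exact: discrete_open.
by apply/seteqP; split=> x /=; rewrite -ev_mkP.
Qed.

Lemma hatPtightE : hatPtight U = range xiH.
Proof.
apply/seteqP; split=> [x tx|_ [r _ <-]]; last exact/subset_closure/xi_maximal.
have [r rE] : exists r, val x = xi r; last first.
  by exists r => //; apply: val_inj.
apply: char_eq_xi => [|m m0]; first exact: hatP0_char.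
apply: contrapT => no.
(* Missing every coset of [m] is a condition on finitely many coordinates, hence open. A maximal
   character near [x] would then miss them all too. *)
have : \forall y \near x, forall c : 'I_`|m|%N, ~~ ev (val y) (pj m (c : nat)%:Z).
  pose F (c : 'I_`|m|%N) := [set y : hatP0 U | ~~ ev (val y) (pj m (c : nat)%:Z)].
  apply: (@filter_forall (hatP0 U) 'I_`|m|%N F (nbhs x)) => c.
  have hp := uz_P_pj U (c : nat)%:Z m0.
  have := @eval_continuous (mkP hp) x [set false].
  have -> : val x (mkP hp) = false.
    by apply/negP; rewrite -ev_mkP => h; apply: no; exists (c : nat)%:Z.
  move=> H; have {}H : nbhs x [set y : hatP0 U | val y (mkP hp) = false].
    by apply: H; exact: discrete_set1.
  by apply: (@filterS _ (nbhs x) _ _ _ _ H) => y; rewrite /F /= -ev_mkP => ->.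
move=> /tx[y [my yno]].
have [n yn] := maximal_ev my m0.
have lt : (`|(n %% m)%Z| < `|m|)%N.
  by have := modz_ge0 n m0; have := ltz_mod n m0; lia.
have := yno (Ordinal lt); rewrite /= gez0_abs ?modz_ge0 //.
by rewrite (@pj_eqmod _ _ m _ n) ?yn // modz_mod.
Qed.

End Characters.

(** * Topology *)

Lemma nbhsS (T : topologicalType) (x : T) (A B : set T) :
  A `<=` B -> nbhs x A -> nbhs x B.
Proof. by move=> AB; exact: filterS. Qed.

Lemma set_type_prod_cvg (I : Type) (K : I -> topologicalType)
    (A : set (prod_topology K)) (F : set_system (set_type A)) (x : set_type A) :
  Filter F -> (forall i, (fun y => val y i) @ F --> val x i) -> F --> x.
Proof.
move=> FF h V [B [[W oW <-] Wx sBV]].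
suff FW : F (val @^-1` W) by exact: filterS FW.
have : nbhs (val x : prod_topology K) W by exact: open_nbhs_nbhs.
suff H : val @ F --> (val x : prod_topology K) by exact: H.
apply/cvg_sup => i C [D [[E oE <-] Ex sDC]]; apply: filterS sDC _.
by apply: (h i); exact: open_nbhs_nbhs.
Qed.

Lemma Zhat_nbhs_zcong (r : Zhat) m c : zcong r m c -> nbhs r [set t | zcong t m c].
Proof.
move=> rc.
have cont : continuous (fun t : Zhat => zcomp t (absNpos m) : discrete_topology _).
  pose K (m : Npos) : topologicalType := discrete_topology 'I_(val m).
  move=> t; apply: (@continuous_comp Zhat (prod_topology K) (K (absNpos m)) val
    (fun y => y (absNpos m))).
    exact: (@initial_continuous Zhat (prod_topology K) set_val).
  exact: (@proj_continuous Npos K (absNpos m)).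
apply: (nbhsS _ (cont r [set zcomp r (absNpos m)] (discrete_set1 _))).
by move=> t /= tr; rewrite /zcong tr.
Qed.

(** The cosets containing [r] form a filter base, two moduli being refined by their product. This
    filter converges to [r] in each component, so it refines every neighbourhood. *)
Lemma Zhat_nbhsP (r : Zhat) (V : set Zhat) :
  nbhs r V <-> exists2 m : int, m != 0 &
    exists2 c, zcong r m c & [set t | zcong t m c] `<=` V.
Proof.
split=> [rV|[m m0 [c rc sub]]]; last first.
  exact: nbhsS sub (Zhat_nbhs_zcong rc).
pose c (m : int) : int := (zcomp r (absNpos m))%:Z.
pose B m := [set t | zcong t m (c m)].
have cP m : zcong r m (c m) by [].
pose F := filter_from [set m : int | m != 0] B.
have FF : Filter F.
  apply: filter_from_filter; first by exists 1.
  move=> m m' /= m0 m0'; exists (m * m') => [|t]; first by rewrite /= mulf_neq0.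
  rewrite /B /= => h.
  have mm : m * m' != 0 by rewrite mulf_neq0.
  have hm : zcong t m (c (m * m')) by exact: zcong_dvd h.
  have hm' : zcong t m' (c (m * m')) by apply: (@zcong_dvd _ _ m); rewrite mulrC.
  have rm : zcong r m (c (m * m')) by exact: zcong_dvd (cP _).
  have rm' : zcong r m' (c (m * m')).
    by apply: (@zcong_dvd _ _ m); rewrite mulrC //; exact: cP.
  by split; [exact/(zcong_eqmod _ hm)/(zcong_eqmod _ rm)
            |exact/(zcong_eqmod _ hm')/(zcong_eqmod _ rm')].
have : F --> (r : Zhat).
  apply: set_type_prod_cvg => k.
  apply/discrete_cvg; exists (val k)%:Z; first by have := valP k; rewrite /=; lia.
  have kk : absNpos (val k)%:Z = k.
    by apply: val_inj; rewrite absNposE //; have := valP k; lia.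
  move=> t; rewrite /B /= /zcong /c kk => /eqP.
  rewrite !modz_nat !modn_small // => /eqP [] h.
  exact: val_inj.
move=> /(_ V rV)[m m0 sub]; exists m => //.
by exists (c m).
Qed.

Lemma xiH_continuous (R : realType) (U : UZ R) : continuous (@xiH R U).
Proof.
move=> r; have FF : Filter (nbhs r) := @nbhs_filter Zhat r.
apply: set_type_prod_cvg => e; apply/discrete_cvg.
suff h : nbhs r [set t | xi U t e = xi U r e] by exact: h.
case: (uz_P_case (set_type_P e)) => [e0|[m [n [m0 eE]]]].
  apply: (nbhsS _ (@filterT _ (nbhs r) (@nbhs_filter Zhat r))) => t _ /=.
  by apply/idP/idP => /xi_val; rewrite e0 => /hold0.
have [c rc] := zcong_ex r m.
apply: nbhsS (Zhat_nbhs_zcong rc) => t tc /=.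
apply/idP/idP => /xi_val; rewrite eE => /(hold_pj U _ _ m0) hn; apply/xi_val; rewrite eE;
  apply/hold_pj => //.
  by apply/(zcong_eqmod _ rc); exact/(zcong_eqmod _ tc).
by apply/(zcong_eqmod _ tc); exact/(zcong_eqmod _ rc).
Qed.

Lemma embR_continuous : continuous embR.
Proof.
move=> r; apply: (@continuous_comp Zhat Rpre Rlim (existT (fun _ => Zhat) Npos1)).
  exact: existT_continuous.
exact: pi_continuous.
Qed.

(** In the copy of [Zhat] with index [p], the preimage of the image of [V] is [p V]. It is open
    because multiplication by [p] carries [c + m Zhat] onto the coset [p c + p m Zhat]. *)
Lemma embR_open (V : set Zhat) : open V -> open (embR @` V).
Proof.
move=> oV.
suff : open (\pi_({eq_quot Rrel})%qT @^-1` (embR @` V) : set Rpre) by [].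
apply/sigT_openP => p; rewrite openE => x /= [v Vv] /esym/Rin_embR xE.
have /Zhat_nbhsP[m m0 [c vc sub]] : nbhs v V by exact: open_nbhs_nbhs.
have p0 : (val p)%:Z != 0 by have := valP p; lia.
have xc : zcong x ((val p)%:Z * m) ((val p)%:Z * c).
  by apply/zcong_divP => //; exists v.
apply: nbhsS (Zhat_nbhs_zcong xc) => y /(zcong_divP _ _ p0 m0)[t yE tc].
by exists t; [exact: sub|apply/esym/Rin_embR].
Qed.

Lemma RPQ_nbhsP (a : RPQ_Zhat) r g (V : set RPQ_Zhat) : ambient a = (embR r, g) ->
  nbhs a V <-> exists2 m : int, m != 0 & exists2 c, zcong r m c &
    forall t (b : RPQ_Zhat), ambient b = (embR t, g) -> zcong t m c -> V b.
Proof.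
move=> aE; split.
  move=> [B [[W oW <-] Wa sBV]].
  have /= : nbhs (ambient a) W by exact: open_nbhs_nbhs.
  rewrite aE => -[[Q S] /= [hQ hS] sub].
  have /Zhat_nbhsP[m m0 [c rc subm]] : nbhs r (embR @^-1` Q) by exact: embR_continuous.
  exists m => //; exists c => // t b bE tc; apply: sBV; rewrite /=.
  rewrite [X in W X]bE; apply: sub; split=> /=; first exact: (subm t tc).
  exact: nbhs_singleton.
move=> [m m0 [c rc sub]].
have hW : nbhs (ambient a) (embR @` [set t | zcong t m c]° `*` [set g]).
  rewrite aE; exists (embR @` [set t | zcong t m c]°, [set g]) => //=; split=> /=.
    apply: (@open_nbhs_nbhs Rlim); split; first exact/embR_open/open_interior.
    by exists r => //; exact: Zhat_nbhs_zcong.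
  exact: (@discrete_set1 (discrete_topology PQ)).
have : nbhs a (@ambient transf_groupoid _ @^-1`
    (embR @` [set t | zcong t m c]° `*` [set g])).
  exact: (@initial_continuous _ _ (@set_val _ _) a).
apply: filterS => b [[t /interior_subset tc tE] gE].
by apply: (sub t) => //; rewrite [LHS]surjective_pairing -tE gE.
Qed.

(** * Germs *)

Section Germs.
Variables (R : realType) (U : UZ R).
Implicit Types (m n k l c : int) (p q : Defs.Pfun U * U) (r t : Zhat) (g h : PQ).
Local Notation pj := (pj U).
Local Notation Sg := (Sg U).
Local Notation xi := (xi U).

Lemma Sigma_char p : Sigma U p -> is_char U p.1.
Proof. by case=> _ [x _ <-]; exact: hatP0_char. Qed.

Lemma germ_rel_refl p : is_char U p.1 -> germ_rel p p.
Proof. by case=> -[e xe] _ _; split=> //; exists e. Qed.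

Lemma germ_rel_sym p q : germ_rel p q -> germ_rel q p.
Proof. by case=> e [a xa pq]; split=> //; exists a; rewrite -?e. Qed.

Lemma germ_rel_trans p q v : is_char U p.1 ->
  germ_rel p q -> germ_rel q v -> germ_rel p v.
Proof.
move=> cp [e [a xa pq]] [e' [b xb qv]]; split; first by rewrite e.
have ha := set_type_P a; have hb := set_type_P b.
exists (mkP (uz_P_mul ha hb)).
  by rewrite -ev_mkP char_evM // !ev_val xa e.
by rewrite /= -[RHS]mulrA -qv mulrA (uz_P_comm ha hb) -!mulrA pq.
Qed.

Lemma germ_eqP p q : Sigma U p -> Sigma U q -> germ p = germ q <-> germ_rel p q.
Proof.
move=> sp sq; have cp := Sigma_char sp; have cq := Sigma_char sq; split=> [e|pq].
  have : germ q q by split=> //; exact: germ_rel_refl.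
  by rewrite -e => -[].
apply/seteqP; split=> v [sv hv]; split=> //.
  by apply: (germ_rel_trans cq) hv; exact: germ_rel_sym.
exact: (germ_rel_trans cp pq).
Qed.

Lemma germ_setE (c : germs U) p : germ_set c p -> Sigma U p /\ germ_set c = germ p.
Proof.
rewrite /germ_set; have [q sq ->] := set_mem (valP c).
by case=> sp qp; split=> //; exact/germ_eqP.
Qed.

Lemma germ_self p : Sigma U p -> germ p p.
Proof. by move=> sp; split=> //; exact/germ_rel_refl/Sigma_char. Qed.

Lemma germ_mk p : Sigma U p -> exists c : germs U, germ_set c = germ p.
Proof.
move=> sp; have h : [set c | exists2 p, Sigma U p & c = germ p] (germ p) by exists p.
by exists (SigSub (mem_set h)).
Qed.

Lemma Sigma_xi r (s : U) : Sigma U (xi r, s) <-> uz_T U s /\ hold r (s * star s).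
Proof.
split=> [[Ts [x xs /= xE]]|[Ts h]].
  by split=> //; apply/ev_xi; rewrite -xE.
by split=> //; exists (xiH U r) => //; apply/ev_xi.
Qed.

Lemma Sigma_Sg r g : Sigma U (xi r, Sg g) <-> exists t, grel g r t.
Proof.
rewrite -(hold_SgSg U); split=> [/Sigma_xi[]//|h].
by apply/Sigma_xi; split=> //; exact: uz_T_Sg.
Qed.

Lemma germ_rel_xi r r' (s s' : U) : germ_rel (xi r, s) (xi r', s') <->
  r = r' /\ exists2 e, hold r e & e * s = e * s'.
Proof.
split=> [[/xi_inj <- [e /xi_val re ee]]|[<- [e re ee]]].
  by split=> //; exists (val e).
split=> //; exists (mkP (hold_P re)) => //.
exact/xi_val.
Qed.

Lemma germ_rel_PSg r e g : hold r e -> germ_rel (xi r, e * Sg g) (xi r, Sg g).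
Proof.
by move=> re; apply/germ_rel_xi; split=> //; exists e; rewrite // mulrA (uz_PK (hold_P re)).
Qed.

Lemma uz_P_sSs (s e : U) : uz_T U s -> uz_P U e -> uz_P U (s * e * star s).
Proof.
move=> /uz_T_case[q [g [hq ->]]] he.
have := uz_P_Sg g he; move: (Sg g) => S hS.
rewrite starM (star_uz_P hq).
have -> : q * S * e * (star S * q) = q * (S * e * star S) * q by rewrite !mulrA.
by apply: uz_P_mul => //; exact: uz_P_mul.
Qed.

Lemma uz_TK (s : U) : uz_T U s -> s * star s * s = s.
Proof.
move=> /uz_T_case[q [g [hq ->]]].
have := uz_P_SgSg U g; have := SgK U g; move: (Sg g) => S SK hS.
rewrite starM (star_uz_P hq).
transitivity (q * (S * star S) * (q * q) * S); first by rewrite !mulrA.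
rewrite (uz_PK hq) -(uz_P_comm hq (uz_P_mul hq hS)) mulrA (uz_PK hq).
by rewrite -(mulrA q) SK.
Qed.

Lemma Sigma_case r (s : U) : Sigma U (xi r, s) ->
  exists g t, grel g r t /\ germ_rel (xi r, s) (xi r, Sg g).
Proof.
move=> /Sigma_xi[/uz_T_case[q [g [hq ->]]] h].
have hS := uz_P_SgSg U g.
have [rq rS] : hold r q /\ hold r (Sg g * star (Sg g)).
  apply/(hold_mul _ hq hS).
  have : hold r (q * (Sg g * star (Sg g)) * q).
    by move: h; rewrite starM (star_uz_P hq); move: (Sg g) => S; rewrite !mulrA.
  by move=> /(hold_mul _ (uz_P_mul hq hS) hq)[].
have /hold_SgSg[t gt] := rS.
by exists g, t; split=> //; exact: germ_rel_PSg.
Qed.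

Lemma ract_germ r t g (s : U) : uz_T U s -> grel g r t ->
  germ_rel (xi r, s) (xi r, Sg g) -> ract (xi r) s = xi t.
Proof.
move=> Ts gt /germ_rel_xi[_ [e0 re0 es]]; apply/funext => e.
have he := set_type_P e; have he0 := hold_P re0.
have hs := uz_P_sSs Ts he; have hS := uz_P_Sg g he.
have conjE S : e0 * (S * val e * star S) * e0 = e0 * S * val e * star (e0 * S).
  by rewrite starM (star_uz_P he0) !mulrA.
(* Compression by [e0] does not affect the value at [r], and [e0 * s = e0 * Sg g] makes the
   compressed conjugates by [s] and by [Sg g] equal. *)
have iffP (p : U) : uz_P U p -> hold r p <-> hold r (e0 * p * e0).
  move=> hp; have hp' := uz_P_mul he0 hp; split=> [rp|].
    by apply/(hold_mul _ hp' he0); split=> //; apply/hold_mul.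
  by move=> /(hold_mul _ hp' he0)[/(hold_mul _ he0 hp)[]].
apply/idP/idP => [/ev_xi/(iffP _ hs)|/xi_val te].
  rewrite conjE es -conjE => /(iffP _ hS)/(hold_Sg _ _ he)[t' gt' h].
  by apply/xi_val; rewrite (grel_fun gt gt').
apply/ev_xi/(iffP _ hs); rewrite conjE es -conjE; apply/(iffP _ hS)/hold_Sg => //.
by exists t.
Qed.

Lemma germ_rel_mul r t g h (s v : U) : grel g r t ->
  germ_rel (xi r, s) (xi r, Sg g) -> germ_rel (xi t, v) (xi t, Sg h) ->
  germ_rel (xi r, s * v) (xi r, Sg (g * h)%g).
Proof.
move=> gt /germ_rel_xi[_ [e1 re1 es]] /germ_rel_xi[_ [e2 te2 ev2]].
have he1 := hold_P re1; have he2 := hold_P te2.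
have hD := uz_P_SgSg U g; have rD : hold r (Sg g * star (Sg g)).
  by apply/hold_SgSg; exists t.
have hf := uz_P_Sg g he2; have rf : hold r (Sg g * e2 * star (Sg g)).
  by apply/hold_Sg => //; exists t.
have Scomm := Sg_comm g he2; have Smul := Sg_mul U g h.
apply/germ_rel_xi; split=> //.
move: (Sg g) (Sg h) (Sg (g * h)%g) => S S' S'' in es ev2 hD rD hf rf Scomm Smul *.
set D := S * star S in hD rD Smul *; set f := S * e2 * star S in hf rf Scomm *.
clearbody D f.
have hDf := uz_P_mul hD hf.
(* Each factor takes the value 1 at [r] and has one task: [e1] replaces [s] by [Sg g], [f] carries
   [e2] across [Sg g] so that [v] becomes [Sg h], and [D] absorbs the projection from [Sg_mul]. *)
exists (D * f * e1); first by apply/hold_mul => //; split=> //; exact/hold_mul.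
have step : D * f * e1 * (s * v) = D * e1 * f * S * S'.
  rewrite -(mulrA (D * f)) (mulrA e1) es -!mulrA; congr (D * _).
  rewrite !mulrA (uz_P_comm hf he1) -!mulrA; congr (e1 * _).
  by rewrite !mulrA -Scomm -!mulrA ev2.
rewrite step -mulrA Smul !mulrA; congr (_ * _).
have De := uz_P_comm hD he1.
rewrite -(mulrA (D * e1)) -(uz_P_comm hD hf) -!mulrA (mulrA e1) -De !mulrA (uz_PK hD).
by rewrite -mulrA (uz_P_comm he1 hf) mulrA.
Qed.

Lemma grelV g r t : grel g r t -> grel (g^-1)%g t r.
Proof.
have [m [k [n [m0 n0 gE]]]] := PQ_frac g.
move=> /(grelE _ _ m0 n0 gE) e; apply/(grelE _ _ n0 m0 (PQ_frac_inv m0 n0 gE)).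
by rewrite -e mulrNz opprK subrK.
Qed.

Lemma germ_rel_inv r t g (s : U) : uz_T U s -> grel g r t ->
  germ_rel (xi r, s) (xi r, Sg g) ->
  germ_rel (xi t, star s) (xi t, Sg (g^-1)%g).
Proof.
move=> Ts gt /germ_rel_xi[_ [e re es]]; apply/germ_rel_xi; split=> //.
have he := hold_P re; have hD := uz_P_SgSg U g; have SK := SgK U g.
have hs : uz_P U (s * star s) by rewrite -[s in s * _]mulr1; exact: uz_P_sSs (uz_P1 U).
(* This is [e] transported from [r] to [t]. It also equals [star s * e * s], so its products with
   [star s] and [star (Sg g)] are [star (e * s)] and [star (e * Sg g)], which agree. *)
exists (star (Sg g) * e * Sg g).
  rewrite -[X in _ * X]starK star_Sg; apply/hold_Sg => //.
  by exists r => //; exact: grelV.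
rewrite -star_Sg; move: (Sg g) => S in es hD SK *.
have conjE v : star v * e * v = star (e * v) * (e * v).
  by rewrite starM (star_uz_P he) !mulrA -(mulrA _ e e) (uz_PK he).
rewrite {1}conjE -es -conjE.
have starK' v : v * star v * v = v -> uz_P U (v * star v) ->
    star v * e * v * star v = star (e * v).
  move=> vK hv; rewrite -mulrA -mulrA (uz_P_comm he hv) mulrA starM (star_uz_P he).
  by congr (_ * e); rewrite -[RHS](congr1 star vK) !starM starK.
by rewrite (starK' _ (uz_TK Ts) hs) (starK' _ SK hD) es.
Qed.

Lemma germ_Sg_inj r r' g h t : grel g r t ->
  germ_rel (xi r, Sg g) (xi r', Sg h) -> r = r' /\ g = h.
Proof.
move=> gt /germ_rel_xi[<- [e re ee]]; split=> //.
by apply: (Sg_inj (hold_P re) ee re); apply/hold_SgSg; exists t.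
Qed.

End Germs.

(** * The isomorphism *)

Section Iso.
Variables (R : realType) (U : UZ R).
Implicit Types (m n k l c : int) (r t : Zhat) (g h : PQ) (a b : RPQ_Zhat).
Local Notation Sg := (Sg U).
Local Notation xi := (xi U).

Lemma RPQ_case a : exists r g t, ambient a = (embR r, g) /\ grel g r t.
Proof.
have [[r _ rE] [t _ tE]] := set_mem (valP a).
exists r, (ambient a).2, t; split.
  by rewrite [LHS]surjective_pairing; congr (_, _); exact/esym/rE.
by rewrite /grel rE; exact/esym/tE.
Qed.

Lemma RPQ_mk r g t : grel g r t -> exists a, ambient a = (embR r, g).
Proof.
move=> gt; have h : [set x : Rlim * PQ | range embR x.1 /\
    range embR (Ract x.1 x.2)] (embR r, g).
  by split; [exists r|exists t].
by exists (SigSub (mem_set h)).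
Qed.

Lemma RPQ_eq a b r g : ambient a = (embR r, g) -> ambient b = (embR r, g) -> a = b.
Proof. by move=> aE bE; apply: val_inj; exact: etrans aE (esym bE). Qed.

Lemma tight_xi r : ((val : hatP0 U -> Defs.Pfun U) @` hatPtight U) (xi r).
Proof. by rewrite hatPtightE; exists (xiH U r) => //; exists r. Qed.

Lemma tight_xi_ex (x : Defs.Pfun U) :
  ((val : hatP0 U -> Defs.Pfun U) @` hatPtight U) x -> exists r, x = xi r.
Proof. by rewrite hatPtightE => -[_ [r _ <-] <-]; exists r. Qed.

Lemma tight_germ_ex r g t : grel g r t ->
  exists c : tight_groupoid U, germ_set (ambient c) = germ (xi r, Sg g).
Proof.
move=> gt; have sg : Sigma U (xi r, Sg g) by apply/Sigma_Sg; exists t.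
have [c cE] := germ_mk sg.
have h : [set a : germs U | exists x s, [/\ germ_set a (x, s),
       ((val : hatP0 U -> Defs.Pfun U) @` hatPtight U) x &
       ((val : hatP0 U -> Defs.Pfun U) @` hatPtight U) (ract x s)]] c.
  exists (xi r), (Sg g); split; [by rewrite cE; exact: germ_self|exact: tight_xi|].
  rewrite (ract_germ (uz_T_Sg U g) gt) //; first exact: tight_xi.
  exact/germ_rel_refl/xi_char.
by exists (SigSub (mem_set h)).
Qed.

Lemma tight_case (c : tight_groupoid U) : exists r g t,
  grel g r t /\ germ_set (ambient c) = germ (xi r, Sg g).
Proof.
have [x [s [cx /tight_xi_ex[r xE] _]]] := set_mem (valP c).
rewrite xE in cx; have [sg cE] := germ_setE cx.
have [g [t [gt gr]]] := Sigma_case sg.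
exists r, g, t; split=> //; rewrite [LHS]cE; apply/germ_eqP => //.
by apply/Sigma_Sg; exists t.
Qed.

Lemma tight_eq (c c' : tight_groupoid U) :
  germ_set (ambient c) = germ_set (ambient c') -> c = c'.
Proof. by move=> /val_inj/val_inj. Qed.

Lemma open_theta (s : U) (W : set (hatP0 U)) :
  uz_T U s -> open W -> W `<=` dom s -> open (theta (s, W)).
Proof.
move=> Ts oW sub; exists [set theta (s, W)]; last by rewrite bigcup_set1.
by move=> _ ->; exact: (@finI_from1 _ _ _ _ (s, W)).
Qed.

Lemma germs_cvg (F : set_system (germs U)) (c : germs U) : Filter F ->
  (forall s W, uz_T U s -> open W -> W `<=` dom s -> theta (s, W) c ->
     F (theta (s, W))) -> F --> c.
Proof.
move=> FF h V [_ [[D DE <-] [B DB Bc] sub]].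
have [E ED BE] := DE _ DB.
suff FB : F B by apply: filterS FB => x Bx; apply: sub; exists B.
rewrite -BE; apply: filter_bigI => -[s W] /[dup] iE /ED/set_mem[Ts oW sW].
by apply: h => //; move: Bc; rewrite -BE; exact.
Qed.

(** Stated through [Sg g], hence free of any choice of fractions; [SgE] recovers the formula for all
    [m], [k], [n]. *)
Definition phi_spec (phi : RPQ_Zhat -> tight_groupoid U) : Prop :=
  forall a r g, ambient a = (embR r, g) ->
    germ_set (ambient (phi a)) = germ (xi r, Sg g).

Lemma phi_ex : exists phi, phi_spec phi.
Proof.
suff /choice[phi phiP] : forall a, exists c : tight_groupoid U,
    forall r g, ambient a = (embR r, g) ->
      germ_set (ambient c) = germ (xi r, Sg g) by exists phi.
move=> a; have [r [g [t [aE gt]]]] := RPQ_case a.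
have [c cE] := tight_germ_ex gt; exists c => r' g'.
by rewrite aE => -[/embR_inj <- <-].
Qed.

Lemma phi_inj phi : phi_spec phi -> injective phi.
Proof.
move=> phiP a b.
have [r [g [t [aE gt]]]] := RPQ_case a; have [w [h [v [bE hv]]]] := RPQ_case b.
move=> /(congr1 (fun z : tight_groupoid U => germ_set (ambient z))).
rewrite (phiP _ _ _ aE) (phiP _ _ _ bE).
have sg : Sigma U (xi r, Sg g) by apply/Sigma_Sg; exists t.
have sh : Sigma U (xi w, Sg h) by apply/Sigma_Sg; exists v.
move=> /(germ_eqP sg sh)/(germ_Sg_inj gt)[rw gh].
by apply: (RPQ_eq aE); rewrite bE rw gh.
Qed.

Lemma phi_surj phi : phi_spec phi -> forall c : tight_groupoid U, exists a, phi a = c.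
Proof.
move=> phiP c; have [r [g [t [gt cE]]]] := tight_case c.
have [a aE] := RPQ_mk gt; exists a; apply: tight_eq.
by rewrite (phiP _ _ _ aE).
Qed.

Lemma phi_bij phi : phi_spec phi -> bijective phi.
Proof.
move=> phiP; have [psi psiK] := choice (phi_surj phiP).
by exists psi => // a; apply: (phi_inj phiP).
Qed.

Lemma phi_gmul phi : phi_spec phi -> forall a b c : RPQ_Zhat,
  gmul a b c <-> gmul (phi a) (phi b) (phi c).
Proof.
move=> phiP a b c.
have [r [g [t [aE gt]]]] := RPQ_case a; have [t' [h [v [bE hv]]]] := RPQ_case b.
have [w [l [z [cE lz]]]] := RPQ_case c.
have sg : Sigma U (xi r, Sg g) by apply/Sigma_Sg; exists t.
have sh : Sigma U (xi t', Sg h) by apply/Sigma_Sg; exists v.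
have sl : Sigma U (xi w, Sg l) by apply/Sigma_Sg; exists z.
have rg := germ_rel_refl (Sigma_char sg); have rh := germ_rel_refl (Sigma_char sh).
have -> : gmul a b c <->
    (ambient b).1 = Ract (ambient a).1 (ambient a).2 /\
    ambient c = ((ambient a).1, ((ambient a).2 * (ambient b).2)%g) by [].
have -> : gmul (phi a) (phi b) (phi c) <-> exists x s s',
    [/\ germ_set (ambient (phi a)) (x, s),
        germ_set (ambient (phi b)) (ract x s, s')
      & germ_set (ambient (phi c)) (x, s * s')] by [].
rewrite (phiP _ _ _ aE) (phiP _ _ _ bE) (phiP _ _ _ cE) aE bE cE /=.
split=> [[bt [/embR_inj wr lgh]]|[x [s [s' [[ss gs] [ss' gs'] [sss gss]]]]]].
  have tt : t' = t by apply/embR_inj; rewrite bt.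
  rewrite {}wr {}tt {}lgh in sh rh sl hv *.
  exists (xi r), (Sg g), (Sg h); split; first exact: germ_self.
    by rewrite (ract_germ (uz_T_Sg U g) gt rg); exact: germ_self.
  split; last first.
    by apply/germ_rel_sym/(germ_rel_mul gt).
  apply/Sigma_xi; split.
    by rewrite Sg_mul; apply: uz_T_PSg; exact: uz_P_SgSg.
  have : hold r (Sg g * (Sg h * star (Sg h)) * star (Sg g)).
    apply/hold_Sg; first exact: uz_P_SgSg.
    by exists t => //; apply/hold_SgSg; exists v.
  by move: (Sg g) (Sg h) => S S'; rewrite starM !mulrA.
(* Here the product comes with arbitrary representatives [s] and [s']. They are exchanged for [Sg g]
   and [Sg h], after which [germ_Sg_inj] reads off [l = g * h]. *)
have xr : x = xi r by case: gs.
rewrite {}xr in ss gs ss' gs' sss gss.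
have Ts : uz_T U s by case: ss.
have gs1 := germ_rel_sym gs.
have rE := ract_germ Ts gt gs1; rewrite rE in ss' gs'.
have tt : t' = t by case: gs' => /xi_inj.
rewrite {}tt in sh rh hv gs' bE *.
have gs2 := germ_rel_sym gs'.
have gw := germ_rel_mul gt gs1 gs2.
have [wr lgh] := germ_Sg_inj lz (germ_rel_trans (Sigma_char sl) gss gw).
by rewrite wr lgh gt.
Qed.

Lemma phi_ginv phi : phi_spec phi -> forall a b : RPQ_Zhat,
  ginv a b <-> ginv (phi a) (phi b).
Proof.
move=> phiP a b.
have [r [g [t [aE gt]]]] := RPQ_case a; have [t' [h [v [bE hv]]]] := RPQ_case b.
have sg : Sigma U (xi r, Sg g) by apply/Sigma_Sg; exists t.
have sh : Sigma U (xi t', Sg h) by apply/Sigma_Sg; exists v.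
have rg := germ_rel_refl (Sigma_char sg); have rh := germ_rel_refl (Sigma_char sh).
have -> : ginv a b <->
    ambient b = (Ract (ambient a).1 (ambient a).2, ((ambient a).2^-1)%g) by [].
have -> : ginv (phi a) (phi b) <-> exists x s,
    germ_set (ambient (phi a)) (x, s) /\
    germ_set (ambient (phi b)) (ract x s, star s) by [].
rewrite (phiP _ _ _ aE) (phiP _ _ _ bE) aE bE /= gt.
split=> [[/embR_inj tt hg]|[x [s [[ss gs] [ss' gs']]]]].
  rewrite {}tt {}hg in sh rh hv *.
  exists (xi r), (Sg g); split; first exact: germ_self.
  by rewrite (ract_germ (uz_T_Sg U g) gt rg) star_Sg; exact: germ_self.
have xr : x = xi r by case: gs.
rewrite {}xr in ss gs ss' gs'.
have Ts : uz_T U s by case: ss.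
have gs1 := germ_rel_sym gs.
have rE := ract_germ Ts gt gs1; rewrite rE in ss' gs'.
have gi := germ_rel_inv Ts gt gs1.
by have [-> ->] := germ_Sg_inj hv (germ_rel_trans (Sigma_char sh) gs' gi).
Qed.

Lemma phi_continuous phi : phi_spec phi -> continuous phi.
Proof.
move=> phiP a.
have FF : Filter (nbhs a) := @nbhs_filter RPQ_Zhat a.
suff H : (fun b => ambient (phi b)) @ a --> ambient (phi a).
  move=> V [_ [[W oW <-] Wa sub]]; apply: filterS sub _.
  by apply: H; exact: open_nbhs_nbhs.
apply: germs_cvg => s W Ts oW sW [x Wx /= xE].
have [r [g [t [aE gt]]]] := RPQ_case a.
have sg : Sigma U (xi r, Sg g) by apply/Sigma_Sg; exists t.
have sx : Sigma U (val x, s) by split=> //; exists x => //; exact: sW.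
move: xE; rewrite (phiP _ _ _ aE) => /(germ_eqP sg sx) gx.
have xr : x = xiH U r by apply: val_inj; case: gx.
rewrite {}xr in Wx gx; have /germ_rel_xi[_ [e re es]] := gx.
(* The projection [e] that identifies the two germs at [r] still does so at every character where it
   takes the value 1, and this is an open condition. *)
have rW : nbhs (xiH U r) (W `&` [set y : hatP0 U | ev (val y) e]).
  apply: open_nbhs_nbhs; split; first exact: openI (open_eval _).
  by split=> //; exact/ev_xi.
have /Zhat_nbhsP[m m0 [c rc sub]] := xiH_continuous rW.
suff : nbhs a [set b | theta (s, W) (ambient (phi b))] by [].
apply/(RPQ_nbhsP _ aE); exists m => //; exists c => // t' b bE tc.
have [Wt /ev_xi te] := sub _ tc.
have [r' [g' [w [bE' gw]]]] := RPQ_case b.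
move: bE'; rewrite bE => -[/embR_inj tr gg]; rewrite -{}tr -{}gg in gw.
exists (xiH U t') => //; rewrite (phiP _ _ _ bE); apply/germ_eqP.
- by apply/Sigma_Sg; exists w.
- by split=> //; exists (xiH U t') => //; exact: sW.
by apply/germ_rel_xi; split=> //; exists e.
Qed.

Lemma phi_open phi : phi_spec phi -> forall V : set RPQ_Zhat,
  open V -> open (phi @` V).
Proof.
move=> phiP V oV; rewrite openE => _ [a Va <-].
have [r [g [t [aE gt]]]] := RPQ_case a.
have sg : Sigma U (xi r, Sg g) by apply/Sigma_Sg; exists t.
have /(RPQ_nbhsP _ aE)[m m0 [c rc sub]] : nbhs a V by exact: open_nbhs_nbhs.
(* A tight germ in [theta (Sg g, W)] lies over some [xi w] with [w] congruent to [c] modulo [m]. By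
   [germ_Sg_inj] its preimage has the same [g], so it lies in [V]. *)
pose W := [set y : hatP0 U | ev (val y) (pj U m c)] `&` dom (Sg g).
have oW : open W by apply: openI; exact: open_eval.
have oT := open_theta (uz_T_Sg U g) oW (@subIsetr _ _ _).
exists (@ambient (germ_groupoid U) _ @^-1` theta (Sg g, W)); split.
- by exists (theta (Sg g, W)).
- exists (xiH U r); last by rewrite (phiP _ _ _ aE).
  split; first by apply/ev_xi; apply/hold_pj.
  by apply/ev_xi; case/Sigma_xi: sg.
move=> c' [x [/= xc xd] c'E].
have [b bE] := phi_surj phiP c'; exists b => //.
have [w [h [z [bE' hz]]]] := RPQ_case b.
have sh : Sigma U (xi w, Sg h) by apply/Sigma_Sg; exists z.
have sx : Sigma U (val x, Sg g) by split; [exact: uz_T_Sg|exists x].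
move: c'E; rewrite -bE (phiP _ _ _ bE') => /(germ_eqP sh sx) hg.
have xw : val x = xi w by case: hg.
rewrite xw in hg.
have [_ hgE] := germ_Sg_inj hz hg; rewrite {}hgE in bE'.
apply: (sub _ _ bE'); apply/(hold_pj U _ _ m0).
by apply/ev_xi; rewrite -xw; exact: xc.
Qed.

End Iso.

Theorem theorem5p3 (R : realType) (U : UZ R) :
  exists phi : RPQ_Zhat -> tight_groupoid U,
    (forall (a : RPQ_Zhat) (r : Zhat) (m n k : int), m != 0 -> n != 0 ->
       (ambient a).1 = embR r ->
       PQmx (ambient a).2 = aff (k%:Q / m%:Q) (n%:Q / m%:Q) ->
       germ_set (ambient (phi a)) =
         germ (xi U r, star (uz_s U m) * uz_u U k * uz_s U n)) /\
    topological_groupoid_iso phi.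
Proof.
have [phi phiP] := phi_ex U; exists phi; split.
  move=> a r m n k m0 n0 ar aE; rewrite -[star _ * _ * _](SgE U m0 n0 aE).
  by apply: phiP; rewrite -ar -surjective_pairing.
split; first exact: phi_bij.
- by split; [exact: phi_continuous|exact: phi_open].
- exact: phi_gmul.
- exact: phi_ginv.
Qed.
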